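(* Let $a\in(0,1)$, $c\in(0,a)$, and let $P(z) = (z-a)\prod_{j=1}^{n-1}(z-z_j)$ be a polynomial of degree $n$ that contradicts Sendov's conjecture at $a$. Define $\mathcal{N}_0(a) = \frac{32 \log ( 40/a^2 )}{a^2}$, $$\mathcal{N}_1(a) = \max \left \{ 9 \left( \frac{4+2a}{a} \right)^2 , \mathcal{N}_0(a) \right \},\qquad \mathcal{N}_2(a,c) = \max \left \{ 9 \left( \frac{\log ( a/16 )}{\log \left( \frac{c}{1+a} \right) } \right)^2 , \mathcal{N}_0(a) \right \}.$$ If $n \geq \max \{\mathcal{N}_1(a), \mathcal{N}_2(a,c)\}$, then $|P(c)| \leq 1 + a$.
   Context: A polynomial $P(z) = (z-a)\prod_{j=1}^{n-1}(z-z_j)$ with $a\in(0,1)$ and $|z_j|\le 1$ for all $j$ is said to contradict Sendov's conjecture at $a$ if every zero $w$ of $P'$ satisfies $|w-a|>1$. *)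

(* Defs.v *)
From Stdlib Require Import Reals List.
Open Scope R_scope.

Definition Cx : Type := (R * R)%type.
Definition RtoC (x : R) : Cx := (x, 0).
Definition C0 : Cx := (0, 0).
Definition Cadd (z w : Cx) : Cx := (fst z + fst w, snd z + snd w).
Definition Copp (z : Cx) : Cx := (- fst z, - snd z).
Definition Csub (z w : Cx) : Cx := Cadd z (Copp w).
Definition Cmul (z w : Cx) : Cx :=
  (fst z * fst w - snd z * snd w, fst z * snd w + snd z * fst w).
Definition Cnorm (z : Cx) : R := sqrt (fst z * fst z + snd z * snd z).

(* Polynomials over Cx as coefficient lists, lowest degree first:
   [c0; c1; ...; cd] represents c0 + c1 X + ... + cd X^d. *)
Definition cpoly := list Cx.

Fixpoint peval (p : cpoly) (z : Cx) : Cx :=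
  match p with
  | nil => C0
  | c :: p' => Cadd c (Cmul z (peval p' z))
  end.

Fixpoint padd (p q : cpoly) : cpoly :=
  match p, q with
  | nil, _ => q
  | _, nil => p
  | a :: p', b :: q' => Cadd a b :: padd p' q'
  end.

Definition pscale (c : Cx) (p : cpoly) : cpoly := map (Cmul c) p.

Definition pmul_Xsub (r : Cx) (p : cpoly) : cpoly :=
  padd (C0 :: p) (pscale (Copp r) p).

Fixpoint prod_Xsub (rs : list Cx) : cpoly :=
  match rs with
  | nil => RtoC 1 :: nil
  | r :: rs' => pmul_Xsub r (prod_Xsub rs')
  end.

Fixpoint pderiv_aux (k : nat) (p : cpoly) : cpoly :=
  match p with
  | nil => nil
  | c :: p' => Cmul (RtoC (INR k)) c :: pderiv_aux (S k) p'
  end.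
Definition pderiv (p : cpoly) : cpoly :=
  match p with
  | nil => nil
  | _ :: p' => pderiv_aux 1 p'
  end.

Definition sendov_poly (a : R) (zs : list Cx) : cpoly := prod_Xsub (RtoC a :: zs).

Definition contradicts_sendov (a : R) (zs : list Cx) : Prop :=
  forall w : Cx, peval (pderiv (sendov_poly a zs)) w = C0 -> Cnorm (Csub w (RtoC a)) > 1.

Definition N0 (a : R) : R := 32 * ln (40 / a ^ 2) / a ^ 2.
Definition N1 (a : R) : R := Rmax (9 * ((4 + 2 * a) / a) ^ 2) (N0 a).
Definition N2 (a c : R) : R :=
  Rmax (9 * (ln (a / 16) / ln (c / (1 + a))) ^ 2) (N0 a).

(* Main.v *)
(** Let [w_1 .. w_m], [m = n - 1], be the critical points of [P]; by Gauss-Lucas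
    and the hypothesis they lie in the lune [|w| <= 1 <= |a - w|].  Put
    [D s = prod |s - w_i|], so that [|P' s| = n D s], and [M = D a].

    - From [|s - w|^2 = (1 - s/a) |w|^2 + (s/a) |a - w|^2 - s (a - s)], [D] decays
      exponentially away from [a].  Hence [P (a/2)], the integral of [P'] from
      [a] to [a/2], is about [P' a / sum 1/(a - w_i)], of modulus at least about [M].
    - On the other side [|P 0| <= a] bounds [P (a/2)] through the integral of
      [P'] over [[0, a/2]].  Comparison gives [M <= 38/a^2], so that
      [G = sum (|a - w_i|^2 - 1)] is at most [3 m a^2 / 16].
    - If [H = sum (1 - |w_i|^2)] were less than [m a^2 / 4], the [w_i] would have
      mean real part close to [a/2]; so would the roots of [P], which have the
      same centroid, and this makes [P (a/2)] exponentially small, a contradiction.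
    - So [H] is large, [P'] is negligible on [[0, a/2]], and [|P c| <= a + 3/100]
      there.  For [c] in [[a/2, a]] compare [P c] with [P (a/2)] through
      [P c ~ (P' c - P' a) / sum 1/(a - w_i)], or use [|P c| <= n M (a - c)] when
      [m (a - c) <= 17/10]. *)
From Coquelicot Require Import Coquelicot.
From mathcomp Require all_boot all_order all_algebra Rstruct.
From mathcomp.real_closed Require complex.
Require Import Defs.
From Stdlib Require Import Reals List Lra Lia Psatz.
Open Scope R_scope.

Definition sum_over (f : Cx -> R) (zs : list Cx) : R :=
  fold_right (fun z x => f z + x) 0 zs.

(** * Factorisation of the derivative *)

Module CriticalPoints.
Import all_boot all_order all_algebra complex Rstruct.
Import GRing.Theory Num.Theory.
Local Open Scope ring_scope.

(** [Cx] and [R[i]] share their coordinates, so the ring operations agree by computation. The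
    transfer makes the algebraic closedness of [R[i]] available. *)
Definition ofC (z : Cx) : R[i] := Complex z.1 z.2.
Definition toC (z : R[i]) : Cx := (complex.Re z, complex.Im z).
Lemma ofCK : cancel ofC toC. Proof. by case. Qed.
Lemma toCK : cancel toC ofC. Proof. by case. Qed.
Lemma ofCD z w : ofC (Cadd z w) = ofC z + ofC w. Proof. by []. Qed.
Lemma ofCM z w : ofC (Cmul z w) = ofC z * ofC w. Proof. by []. Qed.
Lemma ofCN z : ofC (Copp z) = - ofC z. Proof. by []. Qed.
Lemma ofC0 : ofC C0 = 0. Proof. by []. Qed.
Lemma ofC1 : ofC (RtoC 1%R) = 1. Proof. by []. Qed.
Lemma ofC_nat n : ofC (RtoC (INR n)) = n%:R.
Proof.
elim: n => [//|n IH]; rewrite S_INR mulrSr -IH -ofC1 -ofCD.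
by congr ofC; rewrite /Cadd /RtoC /= Rplus_0_r.
Qed.

Definition toP (p : cpoly) : {poly R[i]} := Poly (List.map ofC p).
Lemma toP_cons c p : toP (c :: p) = toP p * 'X + (ofC c)%:P.
Proof. by rewrite /toP /= cons_poly_def. Qed.

Lemma horner_toP p z : (toP p).[ofC z] = ofC (peval p z).
Proof.
elim: p => [|c p IH]; first by rewrite /toP /= horner0.
by rewrite toP_cons hornerMXaddC IH /= ofCD ofCM addrC mulrC.
Qed.

Lemma toP_add p q : toP (padd p q) = toP p + toP q.
Proof.
elim: p q => [|a p IH] [|b q] /=; rewrite ?[toP [::]]/toP ?add0r ?addr0 //=.
by rewrite !toP_cons IH ofCD polyCD mulrDl addrACA.
Qed.

Lemma toP_scale c p : toP (pscale c p) = (ofC c)%:P * toP p.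
Proof.
elim: p => [|b p IH]; first by rewrite /toP /= mulr0.
by rewrite /= !toP_cons IH ofCM polyCM mulrDr mulrA.
Qed.

Lemma toP_Xsub rs : toP (prod_Xsub rs) = \prod_(z <- map ofC rs) ('X - z%:P).
Proof.
elim: rs => [|r rs IH] /=; first by rewrite big_nil /toP /= cons_poly_def mul0r add0r.
rewrite big_cons -IH /pmul_Xsub toP_add toP_scale toP_cons ofC0 addr0 ofCN polyCN.
by rewrite mulrBl mulNr ['X * _]mulrC.
Qed.

(** [pderiv_aux k] multiplies the coefficient of [X^i] by [k + i], which is the operator
    [X d/dX + k]. Only [k = 1] is wanted, but the induction shifts [k]. *)
Lemma toP_deriv_aux k p : toP (pderiv_aux k p) = (toP p)^`() * 'X + k%:R%:P * toP p.
Proof.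
elim: p k => [|c p IH] k /=; first by rewrite /toP /= deriv0 mulr0 mul0r addr0.
rewrite !toP_cons IH ofCM ofC_nat derivD derivC derivM derivX mulr1 addr0.
rewrite polyCM mulrDr -natr1 polyCD !mulrDl mul1r !mulrA.
by rewrite -!addrA; congr (_ + _); rewrite addrCA.
Qed.

Lemma toP_deriv p : toP (pderiv p) = (toP p)^`().
Proof.
case: p => [|c p] /=; first by rewrite /toP /= deriv0.
by rewrite toP_deriv_aux toP_cons derivD derivC derivM derivX mulr1 mul1r addr0.
Qed.

Lemma Re_sum_ofC zs : complex.Re (\sum_(z <- map ofC zs) z) = sum_over fst zs.
Proof.
elim: zs => [|z zs IH] /=; first by rewrite big_nil.
by rewrite big_cons -IH; case: (\sum_(z <- _) z).
Qed.

Lemma ReMn (z : R[i]) n : complex.Re (z *+ n) = Rmult (INR n) (complex.Re z).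
Proof.
rewrite -mulr_natl -ofC_nat; case: z => x y /=.
by change (Rminus (Rmult (INR n) x) (Rmult 0%R y) = Rmult (INR n) x); rewrite Rmult_0_l Rminus_0_r.
Qed.

(** The derivative splits over an algebraically closed field, with leading coefficient [m + 1]. The
    last clause, equality of the centroids in real part, compares subleading coefficients through
    Vieta's formula. *)
Lemma pderiv_prod_Xsub (rs : list Cx) (m : nat) :
  length rs = m.+1 -> (0 < m)%N ->
  exists ws, length ws = m /\
    (forall z, peval (pderiv (prod_Xsub rs)) z =
       Cmul (RtoC (INR m.+1)) (peval (prod_Xsub ws) z)) /\
    Rmult (INR m) (sum_over fst rs) = Rmult (INR m.+1) (sum_over fst ws).
Proof.
move=> szr m0; set p := toP (prod_Xsub rs).
have Dp : p = \prod_(z <- map ofC rs) ('X - z%:P) by rewrite /p toP_Xsub.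
have szp : size p = m.+2 by rewrite Dp size_prod_XsubC size_map; congr _.+1.
have lp : p`_m.+1 = 1.
  have : p \is monic by rewrite Dp monic_prod_XsubC.
  by rewrite monicE lead_coefE szp => /eqP.
have ld : p^`()`_m = m.+1%:R by rewrite coef_deriv lp.
have nz : (m.+1%:R : R[i]) != 0 by rewrite pnatr_eq0.
(* The degree drops by exactly one, since the coefficient [m + 1] is nonzero in characteristic
   zero. *)
have szd : size p^`() = m.+1.
  apply/eqP; rewrite eqn_leq; apply/andP; split.
    by have := lt_size_deriv (p := p); rewrite szp ltnS; apply; rewrite -size_poly_eq0 szp.
  by rewrite ltnNge; apply: contra nz => /leq_sizeP /(_ m (leqnn m)); rewrite ld => ->.
have lcd : lead_coef p^`() = m.+1%:R by rewrite lead_coefE szd ld.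
have [ss Dd] := closed_field_poly_normal p^`().
rewrite lcd in Dd.
have szs : size ss = m.
  by have := szd; rewrite Dd size_scale // size_prod_XsubC => -[].
have Ess : map ofC (map toC ss) = ss by rewrite -map_comp map_id_in // => z _; exact: toCK.
exists (map toC ss); split; [|split].
- by rewrite -[LHS]/(size (map toC ss)) size_map.
- move=> z; apply: (can_inj ofCK).
  rewrite ofCM -!horner_toP toP_deriv -/p Dd toP_Xsub Ess ofC_nat.
  by rewrite hornerZ.
(* Coefficient of [X^(m-1)] in the derivative: [- m] times the sum of the roots on one side,
   [- (m + 1)] times the sum of the critical points on the other. *)
have cd : p^`()`_m.-1 = p`_m *+ m by rewrite coef_deriv prednK.
have pm : p`_m = - \sum_(z <- map ofC rs) z.
  rewrite Dp -(coefPn_prod_XsubC (ps := map ofC rs)) size_map -[size rs]/(length rs) szr //.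
move: cd; rewrite pm Dd coefZ -szs coefPn_prod_XsubC ?szs -?lt0n // -{1}Ess.
rewrite mulrN mulNrn => /oppr_inj /(congr1 (@complex.Re R)).
by rewrite mulr_natl !ReMn !Re_sum_ofC.
Qed.
End CriticalPoints.

(** * Polynomials and their increments on the real axis *)

Lemma Cx_ring_theory : ring_theory C0 (RtoC 1) Cadd Cmul Csub Copp eq.
Proof.
  split; intros; unfold Csub, Cadd, Cmul, Copp, C0, RtoC;
  repeat match goal with z : Cx |- _ => destruct z end; simpl; f_equal; ring.
Qed.
Add Ring Cx_ring : Cx_ring_theory.

Lemma Cnorm_Cmod (z : Cx) : Cnorm z = Cmod z.
Proof. unfold Cnorm, Cmod; f_equal; ring. Qed.

Lemma Cnorm_sqr (z : Cx) : Cnorm z ^ 2 = fst z ^ 2 + snd z ^ 2.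
Proof. unfold Cnorm; rewrite pow2_sqrt; nra. Qed.

Lemma Cnorm_ge_0 (z : Cx) : 0 <= Cnorm z.
Proof. apply sqrt_pos. Qed.

Lemma Cnorm_mul (z w : Cx) : Cnorm (Cmul z w) = Cnorm z * Cnorm w.
Proof. rewrite !Cnorm_Cmod; apply Cmod_mult. Qed.

Lemma Cnorm_opp (z : Cx) : Cnorm (Copp z) = Cnorm z.
Proof. rewrite !Cnorm_Cmod; apply Cmod_opp. Qed.

Lemma Cnorm_add_le (z w : Cx) : Cnorm (Cadd z w) <= Cnorm z + Cnorm w.
Proof. rewrite !Cnorm_Cmod; apply Cmod_triangle. Qed.

Lemma Cnorm_sub_le (z w : Cx) : Cnorm (Csub z w) <= Cnorm z + Cnorm w.
Proof. unfold Csub; rewrite <- (Cnorm_opp w); apply Cnorm_add_le. Qed.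

Lemma Cnorm_sub_sym (z w : Cx) : Cnorm (Csub z w) = Cnorm (Csub w z).
Proof. rewrite <- Cnorm_opp; f_equal; ring. Qed.

Lemma Cnorm_RtoC (x : R) : 0 <= x -> Cnorm (RtoC x) = x.
Proof.
  intros; unfold Cnorm; simpl.
  replace (x * x + 0 * 0) with (x * x) by ring; apply sqrt_square; auto.
Qed.

Lemma Cnorm_C0 : Cnorm C0 = 0.
Proof. apply (Cnorm_RtoC 0); lra. Qed.

Lemma Cnorm_pos_neq (z : Cx) : 0 < Cnorm z -> z <> C0.
Proof. intros H ->; rewrite Cnorm_C0 in H; lra. Qed.

Lemma Cinv_r (z : Cx) : 0 < Cnorm z -> Cmul z (Cinv z) = RtoC 1.
Proof. intros H; apply Complex.Cinv_r, (Cnorm_pos_neq z H). Qed.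

Lemma Cnorm_inv (z : Cx) : 0 < Cnorm z -> Cnorm (Cinv z) = / Cnorm z.
Proof. intros H; rewrite !Cnorm_Cmod; apply Cmod_inv, (Cnorm_pos_neq z H). Qed.

Lemma peval_padd (p q : cpoly) (z : Cx) :
  peval (padd p q) z = Cadd (peval p z) (peval q z).
Proof.
  revert q; induction p as [|a p IH]; intros [|b q]; simpl; rewrite ?IH; ring.
Qed.

Lemma peval_pscale (c : Cx) (p : cpoly) (z : Cx) :
  peval (pscale c p) z = Cmul c (peval p z).
Proof.
  unfold pscale; induction p as [|a p IH]; simpl; rewrite ?IH; ring.
Qed.

Lemma peval_pmul_Xsub (r : Cx) (p : cpoly) (z : Cx) :
  peval (pmul_Xsub r p) z = Cmul (Csub z r) (peval p z).
Proof.
  unfold pmul_Xsub; rewrite peval_padd, peval_pscale; simpl; ring.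
Qed.

Lemma peval_pderiv_aux_S (k : nat) (p : cpoly) (z : Cx) :
  peval (pderiv_aux (S k) p) z = Cadd (peval (pderiv_aux k p) z) (peval p z).
Proof.
  revert k; induction p as [|c p IH]; intros k; cbn [pderiv_aux peval]; [ring|].
  rewrite IH, S_INR.
  replace (RtoC (INR k + 1)) with (Cadd (RtoC (INR k)) (RtoC 1)).
  - ring.
  - unfold Cadd, RtoC; simpl; f_equal; ring.
Qed.

Lemma peval_pderiv_cons (c : Cx) (p : cpoly) (z : Cx) :
  peval (pderiv (c :: p)) z = Cadd (peval p z) (Cmul z (peval (pderiv p) z)).
Proof.
  destruct p as [|b p]; cbn [pderiv pderiv_aux peval]; [ring|].
  rewrite peval_pderiv_aux_S; change (RtoC (INR 1)) with (RtoC 1); ring.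
Qed.

Lemma peval_pderiv_padd (p q : cpoly) (z : Cx) :
  peval (pderiv (padd p q)) z = Cadd (peval (pderiv p) z) (peval (pderiv q) z).
Proof.
  revert q; induction p as [|a p IH]; intros [|b q]; cbn [padd]; try (simpl; ring).
  rewrite !peval_pderiv_cons, IH, peval_padd; ring.
Qed.

Lemma peval_pderiv_pscale (c : Cx) (p : cpoly) (z : Cx) :
  peval (pderiv (pscale c p)) z = Cmul c (peval (pderiv p) z).
Proof.
  induction p as [|a p IH]; [simpl; ring|].
  change (pscale c (a :: p)) with (Cmul c a :: pscale c p).
  rewrite !peval_pderiv_cons, IH, peval_pscale; ring.
Qed.

Lemma peval_pderiv_pmul_Xsub (r : Cx) (p : cpoly) (z : Cx) :
  peval (pderiv (pmul_Xsub r p)) z =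
  Cadd (peval p z) (Cmul (Csub z r) (peval (pderiv p) z)).
Proof.
  unfold pmul_Xsub.
  rewrite peval_pderiv_padd, peval_pderiv_pscale, peval_pderiv_cons; ring.
Qed.

(** * Logarithmic derivatives and the Gauss-Lucas theorem *)

Definition log_deriv (ws : list Cx) (z : Cx) : Cx :=
  fold_right (fun w x => Cadd (Cinv (Csub z w)) x) C0 ws.

Lemma peval_pderiv_prod_Xsub (ws : list Cx) (z : Cx) :
  (forall w, In w ws -> 0 < Cnorm (Csub z w)) ->
  peval (pderiv (prod_Xsub ws)) z = Cmul (peval (prod_Xsub ws) z) (log_deriv ws z).
Proof.
  induction ws as [|w ws IH]; intros H; cbn [prod_Xsub]; [simpl; ring|].
  rewrite peval_pderiv_pmul_Xsub, peval_pmul_Xsub, IH by (intros; apply H; now right).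
  change (log_deriv (w :: ws) z)
    with (Cadd (Cinv (Csub z w)) (log_deriv ws z)).
  transitivity (Cadd (Cmul (Cmul (Csub z w) (Cinv (Csub z w))) (peval (prod_Xsub ws) z))
    (Cmul (Csub z w) (Cmul (peval (prod_Xsub ws) z) (log_deriv ws z)))).
  - rewrite Cinv_r by (apply H; now left); ring.
  - ring.
Qed.

Lemma Cnorm_prod_Xsub_pos (ws : list Cx) (z : Cx) :
  (forall w, In w ws -> 0 < Cnorm (Csub z w)) -> 0 < Cnorm (peval (prod_Xsub ws) z).
Proof.
  induction ws as [|w ws IH]; intros H; cbn [prod_Xsub].
  - replace (peval (RtoC 1 :: nil) z) with (RtoC 1) by (simpl; ring).
    rewrite Cnorm_RtoC; lra.
  - rewrite peval_pmul_Xsub, Cnorm_mul; apply Rmult_lt_0_compat.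
    + apply H; now left.
    + apply IH; intros; apply H; now right.
Qed.

(** Each [w / (w - r)] with [|r| <= 1 < |w|] has positive real part, because the scalar product of
    [w] and [w - r] is positive. *)
Lemma log_deriv_outside_disk (rs : list Cx) (w : Cx) :
  1 < Cnorm w -> rs <> nil -> (forall r, In r rs -> Cnorm r <= 1) ->
  0 < fst (Cmul w (log_deriv rs w)).
Proof.
  intros Hw Hne Hr.
  assert (Hterm : forall r, Cnorm r <= 1 -> 0 < fst (Cmul w (Cinv (Csub w r)))).
  { intros r H1.
    pose proof (Cnorm_sqr w) as Ew; pose proof (Cnorm_sqr r) as Er.
    pose proof (Cnorm_ge_0 r).
    destruct w as [x y], r as [u v]; simpl fst in *; simpl snd in *.
    set (W := Cnorm (x, y)) in *; set (V := Cnorm (u, v)) in *.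
    assert (1 < x ^ 2 + y ^ 2) by (rewrite <- Ew; nra).
    assert (u ^ 2 + v ^ 2 <= 1) by (rewrite <- Er; nra).
    (* Twice this scalar product is [|w - r|^2 + |w|^2 - |r|^2]. *)
    assert (Hn : 0 < x * (x - u) + y * (y - v)).
    { pose proof (pow2_ge_0 (x - u)); pose proof (pow2_ge_0 (y - v)); lra. }
    assert (Hd : 0 < (x - u) ^ 2 + (y - v) ^ 2).
    { destruct (Req_dec (x - u) 0) as [H3|H3].
      - assert (H4 : y - v <> 0) by (intros H4; rewrite H3, H4 in Hn; lra).
        pose proof (pow2_ge_0 (x - u)); pose proof (pow2_gt_0 (y - v) H4); lra.
      - pose proof (pow2_gt_0 (x - u) H3); pose proof (pow2_ge_0 (y - v)); lra. }
    unfold Cmul, Cinv, Csub, Cadd, Copp; cbn [fst snd].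
    eapply Rlt_le_trans; [apply (Rdiv_lt_0_compat _ _ Hn Hd)|].
    right; field; unfold Rminus in Hd; lra. }
  clear Hw; induction rs as [|r rs IH]; [congruence|].
  change (log_deriv (r :: rs) w) with (Cadd (Cinv (Csub w r)) (log_deriv rs w)).
  replace (Cmul w (Cadd (Cinv (Csub w r)) (log_deriv rs w))) with
    (Cadd (Cmul w (Cinv (Csub w r))) (Cmul w (log_deriv rs w))) by ring.
  pose proof (Hterm r (Hr r (or_introl eq_refl))) as H1.
  unfold Cadd at 1; cbn [fst].
  destruct rs as [|r' rs].
  - simpl (log_deriv nil w); replace (Cmul w C0) with C0 by ring; simpl fst at 2; lra.
  - assert (H2 : 0 < fst (Cmul w (log_deriv (r' :: rs) w))).
    { apply IH; [congruence|]; intros; apply Hr; now right. }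
    lra.
Qed.

(** Outside the disk the polynomial has no root, so a zero of its derivative would be a zero of
    [log_deriv]; positivity of the real part of [w * log_deriv rs w] forbids that. *)
Theorem Gauss_Lucas_unit_disk (rs : list Cx) (w : Cx) :
  rs <> nil -> (forall r, In r rs -> Cnorm r <= 1) ->
  peval (pderiv (prod_Xsub rs)) w = C0 -> Cnorm w <= 1.
Proof.
  intros Hne Hr Hw; apply Rnot_lt_le; intros H1.
  assert (Hd : forall r, In r rs -> 0 < Cnorm (Csub w r)).
  { intros r Hin; specialize (Hr r Hin).
    pose proof (Cnorm_add_le (Csub w r) r) as Ht.
    replace (Cadd (Csub w r) r) with w in Ht by ring; lra. }
  rewrite (peval_pderiv_prod_Xsub rs w Hd) in Hw.
  pose proof (Cnorm_prod_Xsub_pos rs w Hd) as Hp.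
  pose proof (log_deriv_outside_disk rs w H1 Hne Hr) as Hl.
  apply (f_equal Cnorm) in Hw; rewrite Cnorm_mul, Cnorm_C0 in Hw.
  assert (H0 : Cnorm (log_deriv rs w) = 0) by nra.
  pose proof (Cnorm_mul w (log_deriv rs w)) as Hm; rewrite H0, Rmult_0_r in Hm.
  pose proof (Cnorm_sqr (Cmul w (log_deriv rs w))) as Hs; rewrite Hm in Hs; nra.
Qed.

(** * Differentiation and increments along the real axis *)

Lemma is_derive_horner (f : R -> R) (k s l : R) :
  is_derive f s l -> is_derive (fun x => k + x * f x) s (f s + s * l).
Proof.
  intros H; auto_derive; [eexists; eassumption|].
  replace (Derive _ _) with l by (symmetry; now apply is_derive_unique); ring.
Qed.

Lemma is_derive_peval (p : cpoly) (s : R) :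
  is_derive (fun x => fst (peval p (RtoC x))) s (fst (peval (pderiv p) (RtoC s))) /\
  is_derive (fun x => snd (peval p (RtoC x))) s (snd (peval (pderiv p) (RtoC s))).
Proof.
  induction p as [|c p [IH1 IH2]].
  - split; apply (is_derive_const (V := R_NormedModule) 0).
  - rewrite peval_pderiv_cons; split.
    + apply (is_derive_ext (fun x => fst c + x * fst (peval p (RtoC x)))).
      { intros; simpl; ring. }
      evar_last; [exact (is_derive_horner _ (fst c) _ _ IH1) | simpl; ring].
    + apply (is_derive_ext (fun x => snd c + x * snd (peval p (RtoC x)))).
      { intros; simpl; ring. }
      evar_last; [exact (is_derive_horner _ (snd c) _ _ IH2) | simpl; ring].
Qed.

(** The mean value theorem for [g - f]. It takes the place of integration: later bounds only have to
    supply an explicit primitive. *)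
Lemma is_derive_le (f f' g g' : R -> R) (u v : R) :
  u <= v ->
  (forall s, u <= s <= v -> is_derive f s (f' s)) ->
  (forall s, u <= s <= v -> is_derive g s (g' s)) ->
  (forall s, u <= s <= v -> f' s <= g' s) ->
  f v - f u <= g v - g u.
Proof.
  intros Huv Hf Hg Hle.
  destruct (MVT_gen (fun s => g s - f s) u v (fun s => g' s - f' s)) as [s [Hs E]].
  - rewrite Rmin_left, Rmax_right by lra; intros s Hs.
    apply (is_derive_minus (V := R_NormedModule)); [apply Hg | apply Hf]; lra.
  - rewrite Rmin_left, Rmax_right by lra; intros s Hs.
    apply continuity_pt_minus; apply derivable_continuous_pt;
      [exists (g' s); apply is_derive_Reals, Hg, Hs |
       exists (f' s); apply is_derive_Reals, Hf, Hs].
  - rewrite Rmin_left, Rmax_right in Hs by lra.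
    specialize (Hle s Hs); cbv beta in E; nra.
Qed.

(* The real function compared with [phi] is the projection of [p] on the
   direction of the increment. *)
Lemma peval_increment_le (p : cpoly) (phi phi' : R -> R) (u v : R) :
  u <= v ->
  (forall s, u <= s <= v -> is_derive phi s (phi' s)) ->
  (forall s, u <= s <= v -> Cnorm (peval (pderiv p) (RtoC s)) <= phi' s) ->
  Cnorm (Csub (peval p (RtoC v)) (peval p (RtoC u))) <= phi v - phi u.
Proof.
  intros Huv Hphi Hle.
  set (d := Csub (peval p (RtoC v)) (peval p (RtoC u))).
  pose proof (Cnorm_sqr d) as Ed; pose proof (Cnorm_ge_0 d) as Hd0.
  (* Settles the case [d = 0], where the inequality multiplied by [Cnorm d] says nothing. *)
  assert (Hmono : 0 <= phi v - phi u).
  { pose proof (is_derive_le (fun _ => 0) (fun _ => 0) phi phi' u v Huv) as H.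
    cbv beta in H.
    enough (0 - 0 <= phi v - phi u) by lra.
    apply H; auto.
    - intros; apply (is_derive_const (V := R_NormedModule) 0).
    - intros s Hs; eapply Rle_trans; [apply Cnorm_ge_0 | now apply Hle]. }
  assert (H : Cnorm d ^ 2 <= Cnorm d * (phi v - phi u)).
  { pose proof (is_derive_le
      (fun s => fst d * fst (peval p (RtoC s)) + snd d * snd (peval p (RtoC s)))
      (fun s => fst d * fst (peval (pderiv p) (RtoC s)) +
                snd d * snd (peval (pderiv p) (RtoC s)))
      (fun s => Cnorm d * phi s) (fun s => Cnorm d * phi' s) u v Huv) as H.
    cbv beta in H.
    replace (Cnorm d ^ 2) with
      (fst d * fst (peval p (RtoC v)) + snd d * snd (peval p (RtoC v)) -
       (fst d * fst (peval p (RtoC u)) + snd d * snd (peval p (RtoC u))))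
      by (rewrite Ed; unfold d; simpl; ring).
    replace (Cnorm d * (phi v - phi u)) with (Cnorm d * phi v - Cnorm d * phi u) by ring.
    apply H.
    - intros s _; destruct (is_derive_peval p s) as [D1 D2].
      apply (is_derive_plus (V := R_NormedModule));
        now apply is_derive_scal.
    - intros s Hs; specialize (Hphi s Hs).
      now apply is_derive_scal.
    - intros s Hs; specialize (Hle s Hs).
      set (e := peval (pderiv p) (RtoC s)) in *.
      pose proof (Cnorm_sqr e) as Ee; pose proof (Cnorm_ge_0 e) as He0.
      (* Cauchy-Schwarz in the plane, from Lagrange's identity. *)
      assert (fst d * fst e + snd d * snd e <= Cnorm d * Cnorm e).
      { apply Rnot_lt_le; intros Hlt.
        assert (0 <= Cnorm d * Cnorm e) by nra.
        assert ((Cnorm d * Cnorm e) ^ 2 < (fst d * fst e + snd d * snd e) ^ 2) by nra.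
        assert ((Cnorm d * Cnorm e) ^ 2 =
          (fst d ^ 2 + snd d ^ 2) * (fst e ^ 2 + snd e ^ 2)) by (rewrite <- Ed, <- Ee; ring).
        pose proof (pow2_ge_0 (fst d * snd e - snd d * fst e)); nra. }
      nra. }
  destruct (Req_dec (Cnorm d) 0); nra.
Qed.

(** * Estimates for points of the lune *)

Lemma exp_le_compat (x y : R) : x <= y -> exp x <= exp y.
Proof. intros [H| ->]; [left; now apply exp_increasing | right; reflexivity]. Qed.

Lemma exp_mul_nat (n : nat) (x : R) : exp (INR n * x) = exp x ^ n.
Proof.
  induction n as [|n IH].
  - simpl; rewrite Rmult_0_l; apply exp_0.
  - rewrite S_INR, Rmult_plus_distr_r, Rmult_1_l, exp_plus, IH; simpl; ring.
Qed.

Lemma le_exp_half (x y : R) : 0 <= x -> x ^ 2 <= exp y -> x <= exp (y / 2).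
Proof.
  intros Hx H; apply Rsqr_incr_0_var; [|left; apply exp_pos].
  unfold Rsqr; rewrite <- exp_plus; replace (y / 2 + y / 2) with y by field; nra.
Qed.

(** Squared distances are polynomial in the coordinates, so [1 + x <= exp x] gives factorwise
    exponents that can be summed over the list. *)
Lemma prod_Xsub_sqr_le_exp (f : Cx -> R) (ws : list Cx) (z : Cx) :
  (forall w, In w ws -> Cnorm (Csub z w) ^ 2 <= exp (f w)) ->
  Cnorm (peval (prod_Xsub ws) z) ^ 2 <= exp (sum_over f ws).
Proof.
  induction ws as [|w ws IH]; intros H; cbn [prod_Xsub].
  - replace (peval (RtoC 1 :: nil) z) with (RtoC 1) by (simpl; ring).
    rewrite Cnorm_RtoC by lra; simpl; rewrite exp_0; lra.
  - rewrite peval_pmul_Xsub, Cnorm_mul, Rpow_mult_distr; cbn [sum_over fold_right].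
    rewrite exp_plus; apply Rmult_le_compat; try apply pow2_ge_0.
    + apply H; now left.
    + apply IH; intros; apply H; now right.
Qed.

Lemma prod_Xsub_le_prod_Xsub (ws : list Cx) (y z : Cx) (e : R) :
  (forall w, In w ws -> Cnorm (Csub z w) <= Cnorm (Csub y w) * exp e) ->
  Cnorm (peval (prod_Xsub ws) z) <=
  Cnorm (peval (prod_Xsub ws) y) * exp (INR (length ws) * e).
Proof.
  rewrite exp_mul_nat.
  induction ws as [|w ws IH]; intros H; cbn [prod_Xsub length].
  - simpl; rewrite Rmult_1_r; right; f_equal; ring.
  - rewrite !peval_pmul_Xsub, !Cnorm_mul.
    assert (H1 := H w (or_introl eq_refl)).
    assert (H2 := IH (fun v Hv => H v (or_intror Hv))).
    apply Rle_trans with ((Cnorm (Csub y w) * exp e) *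
      (Cnorm (peval (prod_Xsub ws) y) * exp e ^ length ws)).
    + apply Rmult_le_compat; auto using Cnorm_ge_0.
    + right; simpl; ring.
Qed.

Lemma prod_Xsub_ge_1 (ws : list Cx) (z : Cx) :
  (forall w, In w ws -> 1 <= Cnorm (Csub z w)) ->
  1 <= Cnorm (peval (prod_Xsub ws) z).
Proof.
  induction ws as [|w ws IH]; intros H; cbn [prod_Xsub].
  - replace (peval (RtoC 1 :: nil) z) with (RtoC 1) by (simpl; ring).
    rewrite Cnorm_RtoC; lra.
  - rewrite peval_pmul_Xsub, Cnorm_mul.
    assert (H1 := H w (or_introl eq_refl)).
    assert (H2 := IH (fun v Hv => H v (or_intror Hv))); nra.
Qed.

(** Termwise [1/u - 1/v = (v - u) / (u v)] with [u = y - w], [v = z - w], and [|u v| >= 1/2]. *)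
Lemma Cnorm_log_deriv_sub (ws : list Cx) (y z : Cx) :
  (forall w, In w ws -> 1 <= Cnorm (Csub y w) /\ 1 / 2 <= Cnorm (Csub z w)) ->
  Cnorm (Csub (log_deriv ws y) (log_deriv ws z)) <=
  INR (length ws) * (2 * Cnorm (Csub z y)).
Proof.
  induction ws as [|w ws IH]; intros H.
  - simpl; replace (Csub C0 C0) with C0 by ring; rewrite Cnorm_C0; lra.
  - change (log_deriv (w :: ws) y) with (Cadd (Cinv (Csub y w)) (log_deriv ws y)).
    change (log_deriv (w :: ws) z) with (Cadd (Cinv (Csub z w)) (log_deriv ws z)).
    destruct (H w (or_introl eq_refl)) as [Hy Hz].
    assert (H2 := IH (fun v Hv => H v (or_intror Hv))).
    set (u := Csub y w) in *; set (v := Csub z w) in *.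
    replace (Csub (Cadd (Cinv u) (log_deriv ws y)) (Cadd (Cinv v) (log_deriv ws z)))
      with (Cadd (Csub (Cinv u) (Cinv v)) (Csub (log_deriv ws y) (log_deriv ws z))) by ring.
    eapply Rle_trans; [apply Cnorm_add_le|].
    cbn [length]; rewrite S_INR.
    enough (Cnorm (Csub (Cinv u) (Cinv v)) <= 2 * Cnorm (Csub z y)) by lra.
    assert (E : Csub (Cinv u) (Cinv v) = Cmul (Csub z y) (Cmul (Cinv u) (Cinv v))).
    { replace (Csub z y) with (Csub v u) by (unfold u, v; ring).
      transitivity (Csub (Cmul (Cmul v (Cinv v)) (Cinv u)) (Cmul (Cmul u (Cinv u)) (Cinv v))).
      - rewrite !Cinv_r by lra; ring.
      - ring. }
    rewrite E, !Cnorm_mul, !Cnorm_inv by lra.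
    assert (0 < / Cnorm u <= 1).
    { split; [apply Rinv_0_lt_compat; lra|].
      rewrite <- Rinv_1; apply Rinv_le_contravar; lra. }
    assert (0 < / Cnorm v <= 2).
    { split; [apply Rinv_0_lt_compat; lra|].
      replace 2 with (/ (1 / 2)) by field; apply Rinv_le_contravar; lra. }
    pose proof (Cnorm_ge_0 (Csub z y)).
    assert (/ Cnorm u * / Cnorm v <= 2) by nra; nra.
Qed.

Lemma Cnorm_log_deriv_le (ws : list Cx) (z : Cx) :
  (forall w, In w ws -> 1 <= Cnorm (Csub z w)) ->
  Cnorm (log_deriv ws z) <= INR (length ws).
Proof.
  induction ws as [|w ws IH]; intros H.
  - simpl; rewrite Cnorm_C0; lra.
  - change (log_deriv (w :: ws) z) with (Cadd (Cinv (Csub z w)) (log_deriv ws z)).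
    assert (H1 := H w (or_introl eq_refl)).
    assert (H2 := IH (fun v Hv => H v (or_intror Hv))).
    eapply Rle_trans; [apply Cnorm_add_le|].
    cbn [length]; rewrite S_INR, Cnorm_inv by lra.
    assert (/ Cnorm (Csub z w) <= 1).
    { rewrite <- Rinv_1; apply Rinv_le_contravar; lra. }
    lra.
Qed.

(** * Excess and defect with respect to the two unit circles *)

(** This quantity and [inner_defect] are nonnegative on the lune; their sums over the critical
    points are [G] and [H]. *)
Definition outer_excess (a : R) (w : Cx) : R := Cnorm (Csub (RtoC a) w) ^ 2 - 1.
Definition inner_defect (w : Cx) : R := 1 - Cnorm w ^ 2.

Lemma sum_over_ge_0 (f : Cx -> R) (ws : list Cx) :
  (forall w, In w ws -> 0 <= f w) -> 0 <= sum_over f ws.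
Proof.
  induction ws as [|w ws IH]; intros H; simpl; [lra|].
  assert (H1 := H w (or_introl eq_refl)).
  assert (H2 := IH (fun v Hv => H v (or_intror Hv))); simpl in H2; lra.
Qed.

Lemma sum_over_lin (f g : Cx -> R) (b c d : R) (ws : list Cx) :
  sum_over (fun w => b * f w + c * g w + d) ws =
  b * sum_over f ws + c * sum_over g ws + INR (length ws) * d.
Proof.
  induction ws as [|w ws IH].
  - simpl; ring.
  - change (length (w :: ws)) with (S (length ws)); rewrite S_INR.
    cbn [sum_over fold_right] in *; fold (sum_over f ws) (sum_over g ws).
    unfold sum_over in *; rewrite IH; ring.
Qed.

Lemma sum_over_ext (f g : Cx -> R) (ws : list Cx) :
  (forall w, f w = g w) -> sum_over f ws = sum_over g ws.
Proof.
  intros H; induction ws as [|w ws IH]; simpl; [reflexivity|].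
  rewrite H; f_equal; exact IH.
Qed.

(** Pointwise, [|a - w|^2 - |w|^2 = a^2 - 2 a Re w]. This ties the centroid of the critical points
    to [G] and [H]. *)
Lemma sum_re_critical (a : R) (ws : list Cx) :
  2 * a * sum_over fst ws =
  INR (length ws) * a ^ 2 - sum_over (outer_excess a) ws - sum_over inner_defect ws.
Proof.
  replace (2 * a * sum_over fst ws) with
    (2 * a * sum_over fst ws + 0 * sum_over fst ws + INR (length ws) * 0) by ring.
  rewrite <- sum_over_lin.
  rewrite (sum_over_ext _ (fun w => -1 * outer_excess a w + -1 * inner_defect w + a ^ 2)).
  - rewrite sum_over_lin; ring.
  - intros w; unfold outer_excess, inner_defect; rewrite !Cnorm_sqr; simpl; ring.
Qed.

(** With [A = |a - w|], the lune conditions give [|s - w|^2 <= A^2 (1 - s (a - s))], and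
    [1 - x <= exp (- x)]. *)
Lemma dist_le_dist_exp (a s : R) (w : Cx) :
  0 < a < 1 -> 0 <= s <= a -> Cnorm w <= 1 -> 1 <= Cnorm (Csub (RtoC a) w) ->
  Cnorm (Csub (RtoC s) w) <= Cnorm (Csub (RtoC a) w) * exp (- (s * (a - s) / 2)).
Proof.
  intros Ha Hs Hw Haw.
  apply Rsqr_incr_0_var.
  2: { apply Rmult_le_pos; [apply Cnorm_ge_0 | left; apply exp_pos]. }
  rewrite Rsqr_mult.
  replace (Rsqr (exp (- (s * (a - s) / 2)))) with (exp (- (s * (a - s)))).
  2: { unfold Rsqr; rewrite <- exp_plus; f_equal; field. }
  pose proof (Cnorm_sqr (Csub (RtoC s) w)) as Es.
  pose proof (Cnorm_sqr (Csub (RtoC a) w)) as Ea.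
  pose proof (Cnorm_sqr w) as Ew.
  pose proof (Cnorm_ge_0 w).
  rewrite !Rsqr_pow2.
  set (A := Cnorm (Csub (RtoC a) w)) in *.
  apply Rle_trans with (A ^ 2 * (1 - s * (a - s))).
  - rewrite Es.
    assert (HA : 1 <= A ^ 2) by nra.
    assert (HB : Cnorm w ^ 2 <= 1) by nra.
    set (B := Cnorm w) in *.
    apply Rmult_le_reg_l with a; [lra|].
    assert (I : a * (A ^ 2 * (1 - s * (a - s))) -
      a * (fst (Csub (RtoC s) w) ^ 2 + snd (Csub (RtoC s) w) ^ 2) =
      (a - s) * (1 - B ^ 2 + (A ^ 2 - 1) * (1 - a * s))).
    { rewrite Ea, Ew; simpl; ring. }
    assert (0 <= (A ^ 2 - 1) * (1 - a * s)) by (apply Rmult_le_pos; nra).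
    assert (0 <= (a - s) * (1 - B ^ 2 + (A ^ 2 - 1) * (1 - a * s))) by
      (apply Rmult_le_pos; lra).
    lra.
  - apply Rmult_le_compat_l; [apply pow2_ge_0|].
    pose proof (exp_ineq1_le (- (s * (a - s)))); lra.
Qed.

(** The exponent is exactly [|s - w|^2 - 1], so this is [1 + x <= exp x]. *)
Lemma dist_sqr_le_exp (a s : R) (w : Cx) :
  0 < a ->
  Cnorm (Csub (RtoC s) w) ^ 2 <=
  exp (s / a * outer_excess a w + - (1 - s / a) * inner_defect w + - (s * (a - s))).
Proof.
  intros Ha; eapply Rle_trans; [|apply exp_ineq1_le].
  right; unfold outer_excess, inner_defect; rewrite !Cnorm_sqr; simpl; field; lra.
Qed.

(** Put [r = sqrt A]: then [ln A = 2 ln r >= 2 (1 - 1/r)], while [A^2 - 1] factors through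
    [r - 1]. *)
Lemma sqr_sub_1_le_ln (A : R) : 1 <= A <= 2 -> A ^ 2 - 1 <= 6 * ln A.
Proof.
  intros HA.
  set (r := sqrt A).
  assert (Er : r * r = A) by (apply sqrt_sqrt; lra).
  assert (Hr : 1 <= r) by (rewrite <- sqrt_1; apply sqrt_le_1; lra).
  assert (Hr2 : r <= 3 / 2) by nra.
  assert (Hln : 1 - / r <= ln r).
  { rewrite <- (Ropp_involutive (ln r)), <- ln_Rinv by lra.
    assert (0 < / r) by (apply Rinv_0_lt_compat; lra).
    assert (ln (/ r) <= / r - 1); [|lra].
    apply Rnot_lt_le; intros Hlt; apply exp_increasing in Hlt.
    rewrite exp_ln in Hlt by auto.
    pose proof (exp_ineq1_le (/ r - 1)); lra. }
  assert (El : ln A = 2 * ln r) by (rewrite <- Er, ln_mult by lra; ring).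
  rewrite El.
  enough (A ^ 2 - 1 <= 12 * (1 - / r)) by lra.
  apply Rmult_le_reg_l with r; [lra|].
  replace (r * (12 * (1 - / r))) with (12 * (r - 1)) by (field; lra).
  assert (I : r * (A ^ 2 - 1) = (r - 1) * (r * (r + 1) * (A + 1))) by (rewrite <- Er; ring).
  rewrite I.
  assert (r * (r + 1) * (A + 1) <= 12) by nra.
  nra.
Qed.

(** Distances from [a] to points of the disk are at most 2, so the logarithmic inequality applies to
    every factor. It turns a bound for [M] into one for [G]. *)
Lemma sum_outer_excess_le_ln (a : R) (ws : list Cx) :
  0 < a < 1 ->
  (forall w, In w ws -> Cnorm w <= 1 /\ 1 <= Cnorm (Csub (RtoC a) w)) ->
  sum_over (outer_excess a) ws <= 6 * ln (Cnorm (peval (prod_Xsub ws) (RtoC a))).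
Proof.
  intros Ha; induction ws as [|w ws IH]; intros H; cbn [prod_Xsub sum_over fold_right].
  - replace (peval (RtoC 1 :: nil) (RtoC a)) with (RtoC 1) by (simpl; ring).
    rewrite Cnorm_RtoC, ln_1; lra.
  - rewrite peval_pmul_Xsub, Cnorm_mul.
    destruct (H w (or_introl eq_refl)) as [H1 H2].
    assert (H3 := IH (fun v Hv => H v (or_intror Hv))).
    assert (1 <= Cnorm (peval (prod_Xsub ws) (RtoC a))) by
      (apply prod_Xsub_ge_1; intros v Hv; apply H; now right).
    rewrite ln_mult by lra.
    assert (Cnorm (Csub (RtoC a) w) <= 2).
    { eapply Rle_trans; [apply Cnorm_sub_le|]; rewrite Cnorm_RtoC; lra. }
    pose proof (sqr_sub_1_le_ln (Cnorm (Csub (RtoC a) w)) ltac:(lra)).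
    unfold outer_excess at 1; unfold sum_over in H3; lra.
Qed.

(** For [t <= a/4] use [a - t >= 3a/4]; beyond that, [t (a - t) >= 3a^2/16]. The Gaussian-type bound
    becomes one with an elementary primitive. *)
Lemma exp_decay_split (m a t : R) :
  0 <= m -> 0 < a -> 0 <= t <= a / 2 ->
  exp (- (m * (t * (a - t)) / 2)) <= exp (- (3 * m * a / 8 * t)) + exp (- (3 * (m * a ^ 2) / 32)).
Proof.
  intros Hm Ha Ht.
  pose proof (exp_pos (- (3 * m * a / 8 * t))).
  pose proof (exp_pos (- (3 * (m * a ^ 2) / 32))).
  destruct (Rle_dec t (a / 4)).
  - assert (exp (- (m * (t * (a - t)) / 2)) <= exp (- (3 * m * a / 8 * t))); [|lra].
    apply exp_le_compat.
    assert (t * (3 * a / 4) <= t * (a - t)) by (apply Rmult_le_compat_l; lra).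
    assert (m * (t * (3 * a / 4)) <= m * (t * (a - t))) by (apply Rmult_le_compat_l; lra).
    lra.
  - assert (exp (- (m * (t * (a - t)) / 2)) <= exp (- (3 * (m * a ^ 2) / 32))); [|lra].
    apply exp_le_compat.
    assert (3 * a ^ 2 / 16 <= t * (a - t)) by nra.
    assert (m * (3 * a ^ 2 / 16) <= m * (t * (a - t))) by (apply Rmult_le_compat_l; lra).
    lra.
Qed.

(** * Polynomials contradicting Sendov's conjecture *)

(** The data of the analytic argument: [rs] are all roots of [P], including [a], and [ws] its
    critical points. The last two fields are the form in which the lower bound on the degree is
    used. *)
Record sendov_config (a : R) (m : nat) (rs ws : list Cx) : Prop := {
  config_a : 0 < a < 1;
  config_root : peval (prod_Xsub rs) (RtoC a) = C0;
  config_at_0 : Cnorm (peval (prod_Xsub rs) (RtoC 0)) <= a;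
  config_disk : forall r, In r rs -> Cnorm r <= 1;
  config_length_rs : length rs = S m;
  config_length_ws : length ws = m;
  config_deriv : forall z,
    peval (pderiv (prod_Xsub rs)) z = Cmul (RtoC (INR (S m))) (peval (prod_Xsub ws) z);
  config_centroid : INR m * sum_over fst rs = INR (S m) * sum_over fst ws;
  config_lune : forall w, In w ws -> Cnorm w <= 1 /\ 1 <= Cnorm (Csub (RtoC a) w);
  config_degree : 144 <= INR m * a ^ 2;
  config_degree_exp : exp (- (INR m * a ^ 2 / 32)) <= a ^ 2 / 38
}.

(** On the roots this is [|P s|]; on the critical points it is [D s = |P' s| / (m + 1)]. *)
Definition prod_norm (rs : list Cx) (s : R) : R := Cnorm (peval (prod_Xsub rs) (RtoC s)).

Lemma config_m (a : R) (m : nat) (rs ws : list Cx) :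
  sendov_config a m rs ws -> 144 <= INR m.
Proof.
  intros K; pose proof (config_a _ _ _ _ K); pose proof (config_degree _ _ _ _ K).
  pose proof (pos_INR m); assert (a ^ 2 <= 1) by nra; nra.
Qed.

(** [E] is a common unit: most exponentials in [m a^2] below are rewritten as its powers. *)
Lemma config_small (a : R) (m : nat) (rs ws : list Cx) (E : R) :
  sendov_config a m rs ws -> E = exp (- (INR m * a ^ 2 / 64)) ->
  0 < E <= 1 / 8 /\ E ^ 2 <= a ^ 2 / 38 /\ INR m * a ^ 2 * E <= 64.
Proof.
  intros K HE; pose proof (config_degree _ _ _ _ K) as Hx.
  set (x := INR m * a ^ 2) in *.
  assert (HE0 : 0 < E) by (rewrite HE; apply exp_pos).
  repeat split; auto.
  (* [144/64 = 16 * (9/64)], and [(1 + 9/64)^16 >= 8]. *)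
  - rewrite HE; apply Rle_trans with (exp (INR 16 * (- (9 / 64)))).
    { apply exp_le_compat; rewrite INR_IZR_INZ; simpl; lra. }
    rewrite exp_mul_nat, exp_Ropp.
    assert (73 / 64 <= exp (9 / 64)) by (pose proof (exp_ineq1_le (9 / 64)); lra).
    replace (1 / 8) with (/ 8) by lra.
    rewrite pow_inv; apply Rinv_le_contravar; [lra|].
    apply Rle_trans with ((73 / 64) ^ 16); [lra|].
    apply pow_incr; lra.
  - replace (E ^ 2) with (exp (- (x / 32))); [apply (config_degree_exp _ _ _ _ K)|].
    rewrite HE; simpl; rewrite Rmult_1_r, <- exp_plus; f_equal; field.
  - assert (HI : E * exp (x / 64) = 1).
    { rewrite HE, <- exp_plus; replace (- (x / 64) + x / 64) with 0 by ring; apply exp_0. }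
    pose proof (exp_ineq1_le (x / 64)); nra.
Qed.

Lemma exp_pow_eq (n : nat) (x y : R) : x = INR n * y -> exp x = exp y ^ n.
Proof. intros ->; apply exp_mul_nat. Qed.

Lemma prod_norm_le_at_a (a : R) (m : nat) (rs ws : list Cx) (s : R) :
  sendov_config a m rs ws -> 0 <= s <= a ->
  prod_norm ws s <= prod_norm ws a * exp (- (INR m * (s * (a - s)) / 2)).
Proof.
  intros K Hs; unfold prod_norm.
  replace (- (INR m * (s * (a - s)) / 2)) with
    (INR (length ws) * (- (s * (a - s) / 2)))
    by (rewrite (config_length_ws _ _ _ _ K); field).
  apply prod_Xsub_le_prod_Xsub; intros w Hw.
  destruct (config_lune _ _ _ _ K w Hw).
  apply dist_le_dist_exp; auto; apply (config_a _ _ _ _ K).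
Qed.

(** Complements [prod_norm_le_at_a]: no factor [M], and near 0 the sum [G] has only the small weight
    [s / a]. *)
Lemma prod_norm_le_exp (a : R) (m : nat) (rs ws : list Cx) (s : R) :
  sendov_config a m rs ws ->
  prod_norm ws s <= exp ((s / a * sum_over (outer_excess a) ws
    - (1 - s / a) * sum_over inner_defect ws - INR m * (s * (a - s))) / 2).
Proof.
  intros K; apply le_exp_half; [apply Cnorm_ge_0|].
  eapply Rle_trans.
  - apply prod_Xsub_sqr_le_exp; intros w _.
    apply dist_sqr_le_exp, (config_a _ _ _ _ K).
  - rewrite sum_over_lin, (config_length_ws _ _ _ _ K).
    apply exp_le_compat; right; ring.
Qed.

Lemma prod_norm_at_a_ge_1 (a : R) (m : nat) (rs ws : list Cx) :
  sendov_config a m rs ws -> 1 <= prod_norm ws a.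
Proof.
  intros K; apply prod_Xsub_ge_1; intros w Hw; now apply (config_lune _ _ _ _ K).
Qed.

(* With [P = prod_Xsub rs], [P'' / P' = log_deriv ws] is nearly constant close
   to [a], so [log_deriv ws a * P - P'] hardly varies there. *)
Lemma log_deriv_approx (a : R) (m : nat) (rs ws : list Cx) (c : R) :
  sendov_config a m rs ws -> a / 2 <= c <= a ->
  Cnorm (Cadd (Csub (Cmul (log_deriv ws (RtoC a)) (peval (prod_Xsub rs) (RtoC c)))
                    (Cmul (RtoC (INR (S m))) (peval (prod_Xsub ws) (RtoC c))))
              (Cmul (RtoC (INR (S m))) (peval (prod_Xsub ws) (RtoC a))))
  <= INR (S m) * prod_norm ws a / 10.
Proof.
  intros K Hc.
  pose proof (config_a _ _ _ _ K) as Ha.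
  pose proof (config_m _ _ _ _ K) as Hm.
  pose proof (config_degree _ _ _ _ K) as Hx.
  pose proof (prod_norm_at_a_ge_1 _ _ _ _ K) as HM.
  pose proof (S_INR m) as HN.
  set (N := INR (S m)) in *; set (M := prod_norm ws a) in *.
  set (L := log_deriv ws (RtoC a)).
  set (k := 3 * INR m * a / 8).
  assert (Hma : 0 < INR m * a) by (apply Rmult_lt_0_compat; lra).
  assert (Hk : 0 < k) by (unfold k; lra).
  set (q := exp (- (3 * (INR m * a ^ 2) / 32))).
  assert (Hq : 0 < q) by apply exp_pos.
  (* [p = L P - P'], whose derivative is [P'] times the difference of [L] and the logarithmic
     derivative at the current point. *)
  set (p := padd (pscale L (prod_Xsub rs)) (pscale (Copp (RtoC N)) (prod_Xsub ws))).
  (* [phi] is a primitive of [phi'], the product of the split exponential bound for [|P'|] and the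
     bound [2 m (a - s)] for the variation of [log_deriv]. *)
  set (phi := fun s => - (2 * N * M * INR m) *
    (- ((a - s) / k + / k ^ 2) * exp (- (k * (a - s))) + q * (a - s) ^ 2 / 2)).
  set (phi' := fun s => N * (M * (exp (- (k * (a - s))) + q)) * (INR m * (2 * (a - s)))).
  pose proof (peval_increment_le p phi phi' c a ltac:(lra)) as Hinc.
  assert (Hpd : forall s, a / 2 <= s <= a ->
    Cnorm (peval (pderiv p) (RtoC s)) <= phi' s).
  { intros s Hs.
    assert (Hd : forall w, In w ws ->
      1 <= Cnorm (Csub (RtoC a) w) /\ 1 / 2 <= Cnorm (Csub (RtoC s) w)).
    { intros w Hw; destruct (config_lune _ _ _ _ K w Hw) as [_ H1]; split; auto.
      (* Moving from [a] by at most [a/2 < 1/2] leaves a distance of at least [1/2] to every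
         critical point. *)
      pose proof (Cnorm_add_le (Csub (RtoC s) w) (RtoC (a - s))) as Ht.
      replace (Cadd (Csub (RtoC s) w) (RtoC (a - s))) with (Csub (RtoC a) w) in Ht.
      - rewrite (Cnorm_RtoC (a - s)) in Ht by lra; lra.
      - destruct w; unfold Csub, Cadd, Copp, RtoC; simpl; f_equal; ring. }
    pose proof (Cnorm_log_deriv_sub ws (RtoC a) (RtoC s) Hd) as HL.
    fold L in HL; rewrite (config_length_ws _ _ _ _ K) in HL.
    replace (Cnorm (Csub (RtoC s) (RtoC a))) with (a - s) in HL.
    2: { rewrite Cnorm_sub_sym.
         replace (Csub (RtoC a) (RtoC s)) with (RtoC (a - s)).
         - rewrite Cnorm_RtoC; lra.
         - unfold Csub, Cadd, Copp, RtoC; simpl; f_equal; ring. }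
    unfold p.
    rewrite peval_pderiv_padd, !peval_pderiv_pscale, (config_deriv _ _ _ _ K).
    rewrite (peval_pderiv_prod_Xsub ws) by (intros w Hw; destruct (Hd w Hw); lra).
    fold N.
    set (Q := peval (prod_Xsub ws) (RtoC s)).
    replace (Cadd (Cmul L (Cmul (RtoC N) Q))
      (Cmul (Copp (RtoC N)) (Cmul Q (log_deriv ws (RtoC s))))) with
      (Cmul (Cmul (RtoC N) Q) (Csub L (log_deriv ws (RtoC s)))) by ring.
    rewrite !Cnorm_mul, Cnorm_RtoC by lra.
    unfold phi'.
    apply Rmult_le_compat; auto using Cnorm_ge_0.
    - apply Rmult_le_pos; [lra | apply Cnorm_ge_0].
    - apply Rmult_le_compat_l; [lra|].
      eapply Rle_trans; [apply (prod_norm_le_at_a _ _ _ _ s K); lra|].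
      fold M; apply Rmult_le_compat_l; [lra|].
      replace (s * (a - s)) with ((a - s) * (a - (a - s))) by ring.
      eapply Rle_trans; [apply exp_decay_split; lra|].
      apply Rle_refl. }
  assert (Hphi : forall s, c <= s <= a -> is_derive phi s (phi' s)).
  { intros s _; unfold phi, phi'; auto_derive; [auto|].
    unfold Rminus; field; lra. }
  specialize (Hinc Hphi (fun s Hs => Hpd s ltac:(lra))).
  (* Since [P a = 0], the increment [p a - p c] is the opposite of the quantity to be bounded. *)
  unfold p in Hinc; rewrite !peval_padd, !peval_pscale, (config_root _ _ _ _ K) in Hinc.
  rewrite <- Cnorm_opp.
  match type of Hinc with ?l <= _ => match goal with |- ?l' <= _ =>
    replace l' with l by (f_equal; ring) end end.
  eapply Rle_trans; [exact Hinc|].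
  destruct (config_small _ _ _ _ _ K eq_refl) as [[HE0 HE1] [HE2 HE3]].
  assert (Eq : q = exp (- (INR m * a ^ 2 / 64)) ^ 6).
  { apply exp_pow_eq; rewrite INR_IZR_INZ; simpl; field. }
  set (E := exp (- (INR m * a ^ 2 / 64))) in *.
  set (x := INR m * a ^ 2) in *.
  assert (HE5 : E ^ 5 <= (1 / 8) ^ 5) by (apply pow_incr; lra).
  assert (Hxq : x * q <= 64 * (1 / 8) ^ 5).
  { rewrite Eq; replace (x * E ^ 6) with ((x * E) * E ^ 5) by ring.
    apply Rmult_le_compat; try lra; [nra | apply pow_le; lra]. }
  assert (Hphi_le : phi a - phi c <= 2 * N * M * INR m * (/ k ^ 2 + q * a ^ 2 / 8)).
  { unfold phi.
    replace (a - a) with 0 by ring.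
    replace (- (k * 0)) with 0 by ring; rewrite exp_0.
    set (t := a - c).
    assert (0 <= (t / k + / k ^ 2) * exp (- (k * t))).
    { apply Rmult_le_pos; [|left; apply exp_pos].
      apply Rplus_le_le_0_compat.
      - apply Rdiv_le_0_compat; unfold t; lra.
      - left; apply Rinv_0_lt_compat, pow_lt; lra. }
    assert (t ^ 2 <= (a / 2) ^ 2) by (apply pow_incr; unfold t; lra).
    assert (q * t ^ 2 <= q * (a / 2) ^ 2) by (apply Rmult_le_compat_l; lra).
    assert (0 <= 2 * N * M * INR m) by (repeat apply Rmult_le_pos; lra).
    replace (- (0 / k + / k ^ 2) * 1 + q * 0 ^ 2 / 2) with (- / k ^ 2)
      by (unfold Rdiv; ring).
    assert (/ k ^ 2 - (t / k + / k ^ 2) * exp (- (k * t)) + q * t ^ 2 / 2 <=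
      / k ^ 2 + q * a ^ 2 / 8) by lra.
    match goal with |- ?l <= _ => replace l with (2 * N * M * INR m *
      (/ k ^ 2 - (t / k + / k ^ 2) * exp (- (k * t)) + q * t ^ 2 / 2)) by ring end.
    now apply Rmult_le_compat_l. }
  eapply Rle_trans; [exact Hphi_le|].
  replace (2 * N * M * INR m * (/ k ^ 2 + q * a ^ 2 / 8)) with
    (N * M * (128 / 9 * / x + x * q / 4)).
  2: { unfold k, x; field; lra. }
  assert (/ x <= / 144) by (apply Rinv_le_contravar; lra).
  assert (0 <= N * M) by (apply Rmult_le_pos; lra).
  (* [128 / (9 * 144) < 0.0988] and [x q / 4 <= 16 / 8^5 < 0.0005]. *)
  assert (128 / 9 * / x + x * q / 4 <= 1 / 10) by lra.
  nra.
Qed.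

Lemma Cnorm_log_deriv_at_a (a : R) (m : nat) (rs ws : list Cx) :
  sendov_config a m rs ws -> Cnorm (log_deriv ws (RtoC a)) <= INR m.
Proof.
  intros K; rewrite <- (config_length_ws _ _ _ _ K).
  apply Cnorm_log_deriv_le; intros w Hw; now apply (config_lune _ _ _ _ K).
Qed.

Lemma log_deriv_mul_prod_norm_le (a : R) (m : nat) (rs ws : list Cx) (c : R) :
  sendov_config a m rs ws -> a / 2 <= c <= a ->
  Cnorm (log_deriv ws (RtoC a)) * prod_norm rs c <=
  INR (S m) * (11 / 10 * prod_norm ws a + prod_norm ws c).
Proof.
  intros K Hc; pose proof (log_deriv_approx a m rs ws c K Hc) as H.
  unfold prod_norm in *; rewrite <- Cnorm_mul.
  set (X := Cmul (log_deriv ws (RtoC a)) (peval (prod_Xsub rs) (RtoC c))) in *.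
  set (Y := peval (prod_Xsub ws) (RtoC c)) in *.
  set (Z := peval (prod_Xsub ws) (RtoC a)) in *.
  set (N := INR (S m)) in *.
  assert (0 <= N) by apply pos_INR.
  pose proof (Cnorm_add_le (Cadd (Csub X (Cmul (RtoC N) Y)) (Cmul (RtoC N) Z))
    (Csub (Cmul (RtoC N) Y) (Cmul (RtoC N) Z))) as H1.
  pose proof (Cnorm_sub_le (Cmul (RtoC N) Y) (Cmul (RtoC N) Z)) as H2.
  rewrite !Cnorm_mul, Cnorm_RtoC in H2 by auto.
  replace (Cadd (Cadd (Csub X (Cmul (RtoC N) Y)) (Cmul (RtoC N) Z))
    (Csub (Cmul (RtoC N) Y) (Cmul (RtoC N) Z))) with X in H1 by ring.
  lra.
Qed.

(** At [a/2] the derivative has decayed to at most [M E^8 <= M / 1000], so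
    [899/1000 = 1 - 1/10 - 1/1000] remains from [log_deriv_approx]. *)
Lemma prod_norm_at_a_le_log_deriv_mul (a : R) (m : nat) (rs ws : list Cx) :
  sendov_config a m rs ws ->
  899 / 1000 * (INR (S m) * prod_norm ws a) <=
  Cnorm (log_deriv ws (RtoC a)) * prod_norm rs (a / 2).
Proof.
  intros K; pose proof (config_a _ _ _ _ K) as Ha.
  pose proof (log_deriv_approx a m rs ws (a / 2) K ltac:(lra)) as H.
  pose proof (prod_norm_le_at_a a m rs ws (a / 2) K ltac:(lra)) as HD.
  destruct (config_small _ _ _ _ _ K eq_refl) as [[HE0 HE1] _].
  rewrite (exp_pow_eq 8 _ (- (INR m * a ^ 2 / 64))) in HD
    by (rewrite INR_IZR_INZ; simpl; field).
  set (E := exp (- (INR m * a ^ 2 / 64))) in *.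
  assert (HE8 : E ^ 8 <= (1 / 8) ^ 8) by (apply pow_incr; lra).
  pose proof (prod_norm_at_a_ge_1 _ _ _ _ K) as HM.
  assert (HD' : prod_norm ws (a / 2) <= prod_norm ws a / 1000) by nra.
  clear HD; unfold prod_norm in *; rewrite <- Cnorm_mul.
  set (X := Cmul (log_deriv ws (RtoC a)) (peval (prod_Xsub rs) (RtoC (a / 2)))) in *.
  set (Y := peval (prod_Xsub ws) (RtoC (a / 2))) in *.
  set (Z := peval (prod_Xsub ws) (RtoC a)) in *.
  set (N := INR (S m)) in *.
  assert (0 <= N) by apply pos_INR.
  pose proof (Cnorm_sub_le (Cadd (Csub X (Cmul (RtoC N) Y)) (Cmul (RtoC N) Z))
    (Csub X (Cmul (RtoC N) Y))) as H1.
  pose proof (Cnorm_sub_le X (Cmul (RtoC N) Y)) as H2.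
  rewrite !Cnorm_mul, Cnorm_RtoC in H2 by auto.
  replace (Csub (Cadd (Csub X (Cmul (RtoC N) Y)) (Cmul (RtoC N) Z))
    (Csub X (Cmul (RtoC N) Y))) with (Cmul (RtoC N) Z) in H1 by ring.
  rewrite Cnorm_mul, Cnorm_RtoC in H1 by auto.
  nra.
Qed.

Lemma prod_norm_at_a_le (a : R) (m : nat) (rs ws : list Cx) :
  sendov_config a m rs ws ->
  899 / 1000 * prod_norm ws a <= prod_norm rs (a / 2).
Proof.
  intros K; pose proof (prod_norm_at_a_le_log_deriv_mul _ _ _ _ K) as H.
  pose proof (Cnorm_log_deriv_at_a _ _ _ _ K) as H1.
  pose proof (config_m _ _ _ _ K) as Hm.
  rewrite S_INR in H.
  pose proof (prod_norm_at_a_ge_1 _ _ _ _ K) as HM.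
  assert (0 <= prod_norm rs (a / 2)) by apply Cnorm_ge_0.
  set (s := Cnorm (log_deriv ws (RtoC a))) in *.
  set (y := prod_norm rs (a / 2)) in *.
  assert (s * y <= INR m * y) by (apply Rmult_le_compat_r; lra).
  apply Rmult_le_reg_l with (INR m); [lra|]; nra.
Qed.

(** Integration of [P'] from 0, where [|P 0| <= a]. The majorant has the shape that the two later
    applications produce. *)
Lemma prod_norm_left_le (a : R) (m : nat) (rs ws : list Cx) (c A B k l d : R) :
  sendov_config a m rs ws -> 0 <= c <= a / 2 ->
  0 <= A -> 0 <= B -> 0 < k -> 0 < l -> 0 <= d ->
  (forall s, 0 <= s <= a / 2 ->
     prod_norm ws s <= A * exp (- (k * s)) + B * exp (- (l * s)) + d) ->
  prod_norm rs c <= a + INR (S m) * (A / k + B / l + d * a / 2).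
Proof.
  intros K Hc HA HB Hk Hl Hd HD.
  set (N := INR (S m)); assert (HN : 0 <= N) by apply pos_INR.
  pose proof (peval_increment_le (prod_Xsub rs)
    (fun s => N * (- (A / k) * exp (- (k * s)) - B / l * exp (- (l * s)) + d * s))
    (fun s => N * (A * exp (- (k * s)) + B * exp (- (l * s)) + d)) 0 c ltac:(lra)) as H.
  cbv beta in H.
  pose proof (Cnorm_add_le (Csub (peval (prod_Xsub rs) (RtoC c)) (peval (prod_Xsub rs) (RtoC 0)))
    (peval (prod_Xsub rs) (RtoC 0))) as H1.
  pose proof (config_at_0 _ _ _ _ K) as H2.
  match type of H1 with Cnorm ?u <= _ =>
    replace u with (peval (prod_Xsub rs) (RtoC c)) in H1 by ring end.
  unfold prod_norm at 1; eapply Rle_trans; [exact H1|].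
  apply Rle_trans with (Cnorm (Csub (peval (prod_Xsub rs) (RtoC c))
    (peval (prod_Xsub rs) (RtoC 0))) + a); [lra|].
  rewrite Rplus_comm; apply Rplus_le_compat_l.
  eapply Rle_trans; [apply H|].
  - intros s _; auto_derive; [auto|]; field; lra.
  - intros s Hs; rewrite (config_deriv _ _ _ _ K), Cnorm_mul, Cnorm_RtoC by apply pos_INR.
    apply Rmult_le_compat_l; auto; apply HD; lra.
  - replace (- (k * 0)) with 0 by ring; replace (- (l * 0)) with 0 by ring; rewrite exp_0.
    assert (0 <= A / k) by (apply Rdiv_le_0_compat; lra).
    assert (0 <= B / l) by (apply Rdiv_le_0_compat; lra).
    pose proof (exp_pos (- (k * c))); pose proof (exp_pos (- (l * c))).
    assert (0 <= A / k * exp (- (k * c))) by (apply Rmult_le_pos; lra).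
    assert (0 <= B / l * exp (- (l * c))) by (apply Rmult_le_pos; lra).
    assert (d * c <= d * a / 2) by nra.
    rewrite <- Rmult_minus_distr_l; apply Rmult_le_compat_l; lra.
Qed.

(** * Bounds for [M], [G] and [H] *)

Lemma config_sums_ge_0 (a : R) (m : nat) (rs ws : list Cx) :
  sendov_config a m rs ws ->
  0 <= sum_over (outer_excess a) ws /\ 0 <= sum_over inner_defect ws.
Proof.
  intros K; split; apply sum_over_ge_0; intros w Hw;
    destruct (config_lune _ _ _ _ K w Hw); unfold outer_excess, inner_defect.
  - nra.
  - pose proof (Cnorm_ge_0 w); nra.
Qed.

(** Integrating from 0 bounds [|P (a/2)|] by a multiple of [sqrt M / a] plus small terms, whereas
    [|P (a/2)| >= 0.899 M]. Hence [sqrt M * a] is bounded. *)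
Lemma config_prod_norm_at_a_sqr (a : R) (m : nat) (rs ws : list Cx) :
  sendov_config a m rs ws -> prod_norm ws a * a ^ 2 <= 38.
Proof.
  intros K.
  pose proof (config_a _ _ _ _ K) as Ha.
  pose proof (config_m _ _ _ _ K) as Hm.
  pose proof (config_degree _ _ _ _ K) as Hx.
  pose proof (prod_norm_at_a_ge_1 _ _ _ _ K) as HM.
  pose proof (sum_outer_excess_le_ln a ws Ha (config_lune _ _ _ _ K)) as HG.
  fold (prod_norm ws a) in HG.
  destruct (config_sums_ge_0 _ _ _ _ K) as [HG0 HH0].
  destruct (config_small _ _ _ _ _ K eq_refl) as [[HE0 HE1] [HE2 HE3]].
  set (M := prod_norm ws a) in *.
  set (G := sum_over (outer_excess a) ws) in *.
  set (H := sum_over inner_defect ws) in *.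
  set (r := exp (ln M / 2)).
  assert (Hr2 : r * r = M).
  { unfold r; rewrite <- exp_plus; replace (ln M / 2 + ln M / 2) with (ln M) by field.
    apply exp_ln; lra. }
  assert (Hr0 : 0 < r) by apply exp_pos.
  assert (Hr1 : 1 <= r) by nra.
  assert (Hma : 0 < INR m * a) by (apply Rmult_lt_0_compat; lra).
  (* [k] is the rate of [exp_decay_split]. Lowering it to [l] frees [(k - l) s >= 5 m a^2 / 96] for
     [s >= a/6], enough for the factor [E^3]. *)
  set (k := 3 * INR m * a / 8); set (l := INR m * a / 16).
  set (q := exp (- (3 * (INR m * a ^ 2) / 32))).
  assert (Hq : 0 < q) by apply exp_pos.
  assert (Eq : q = exp (- (INR m * a ^ 2 / 64)) ^ 6).
  { apply exp_pow_eq; rewrite INR_IZR_INZ; simpl; field. }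
  assert (E3 : exp (- (3 * (INR m * a ^ 2) / 64)) = exp (- (INR m * a ^ 2 / 64)) ^ 3).
  { apply exp_pow_eq; rewrite INR_IZR_INZ; simpl; field. }
  set (E := exp (- (INR m * a ^ 2 / 64))) in *.
  assert (HD : forall s, 0 <= s <= a / 2 -> prod_norm ws s <=
    r * exp (- (k * s)) + M * E ^ 3 * exp (- (l * s)) + M * q).
  { intros s Hs.
    pose proof (exp_pos (- (k * s))) as Hk; pose proof (exp_pos (- (l * s))) as Hl.
    assert (0 <= r * exp (- (k * s))) by (apply Rmult_le_pos; lra).
    assert (0 < E ^ 3) by (apply pow_lt; lra).
    assert (0 <= M * E ^ 3 * exp (- (l * s))) by (repeat apply Rmult_le_pos; lra).
    assert (0 <= M * q) by (apply Rmult_le_pos; lra).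
    assert (Hms : 0 <= INR m * s) by (apply Rmult_le_pos; lra).
    (* Up to [a/6] the weight [s / a <= 1/6] cancels the 6 in [G <= 6 ln M], which leaves
       [exp (ln M / 2) = r]. *)
    destruct (Rle_dec s (a / 6)) as [Hs6|Hs6].
    - enough (prod_norm ws s <= r * exp (- (k * s))) by lra.
      eapply Rle_trans; [apply (prod_norm_le_exp _ _ _ _ s K)|].
      fold G H; unfold r; rewrite <- exp_plus; apply exp_le_compat.
      assert (Ht : 0 <= s / a <= 1 / 6).
      { split; [apply Rdiv_le_0_compat; lra|].
        apply Rmult_le_reg_r with a; [lra|]; field_simplify; lra. }
      assert (s / a * G <= 1 / 6 * G) by (apply Rmult_le_compat_r; lra).
      assert (0 <= (1 - s / a) * H) by (apply Rmult_le_pos; lra).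
      assert (INR m * s * (5 * a / 6) <= INR m * s * (a - s)) by
        (apply Rmult_le_compat_l; lra).
      assert (0 <= INR m * s * a) by (apply Rmult_le_pos; lra).
      unfold k; lra.
    - enough (prod_norm ws s <= M * E ^ 3 * exp (- (l * s)) + M * q) by lra.
      eapply Rle_trans; [apply (prod_norm_le_at_a _ _ _ _ s K); lra|].
      fold M; rewrite Rmult_assoc, <- Rmult_plus_distr_l.
      apply Rmult_le_compat_l; [lra|].
      eapply Rle_trans; [apply exp_decay_split; lra|].
      fold q; apply Rplus_le_compat_r.
      rewrite <- E3, <- exp_plus; apply exp_le_compat.
      assert (INR m * a * (a / 6) <= INR m * a * s) by (apply Rmult_le_compat_l; lra).
      unfold l; lra. }
  pose proof (prod_norm_left_le a m rs ws (a / 2) r (M * E ^ 3) k l (M * q) K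
    ltac:(lra) ltac:(lra) ltac:(apply Rmult_le_pos; [lra | apply pow_le; lra])
    ltac:(unfold k; lra) ltac:(unfold l; lra) ltac:(apply Rmult_le_pos; lra) HD) as HP.
  pose proof (prod_norm_at_a_le _ _ _ _ K) as HP'; fold M in HP'.
  rewrite S_INR in HP.
  set (x := INR m * a ^ 2) in *.
  set (rho := (INR m + 1) / INR m).
  assert (Hrho : 1 <= rho <= 145 / 144).
  { unfold rho; replace ((INR m + 1) / INR m) with (1 + / INR m) by (field; lra).
    assert (/ INR m <= / 144) by (apply Rinv_le_contravar; lra).
    assert (0 < / INR m) by (apply Rinv_0_lt_compat; lra); lra. }
  assert (I : a * ((INR m + 1) * (r / k + M * E ^ 3 / l + M * q * a / 2)) =
    rho * (8 / 3 * r + 16 * (M * E ^ 3) + M * (x * q) / 2)).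
  { unfold rho, k, l, x; field; lra. }
  (* [304 = 8 * 38]. The error terms become small multiples of [M a], to be absorbed on the left. *)
  assert (HE3' : E ^ 3 <= a ^ 2 / 304).
  { replace (E ^ 3) with (E * E ^ 2) by ring.
    apply Rle_trans with (1 / 8 * (a ^ 2 / 38)); [|lra].
    apply Rmult_le_compat; try lra; apply pow2_ge_0. }
  assert (Hxq : x * q <= a ^ 2 / 304).
  { rewrite Eq; replace (x * E ^ 6) with ((x * E) * (E ^ 2 * E ^ 3)) by ring.
    assert (E ^ 2 <= 1 / 64) by nra.
    assert (0 < E ^ 3) by (apply pow_lt; lra).
    pose proof (pow2_ge_0 E).
    apply Rle_trans with (64 * (1 / 64 * (a ^ 2 / 304))); [|lra].
    apply Rmult_le_compat; try nra. }
  assert (a ^ 2 <= a) by nra.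
  assert (H1 : M * E ^ 3 <= M * (a / 304)) by (apply Rmult_le_compat_l; lra).
  assert (H2 : M * (x * q) <= M * (a / 304)) by (apply Rmult_le_compat_l; lra).
  assert (HMa : 0 <= M * a) by (apply Rmult_le_pos; lra).
  assert (H3 : rho * (8 / 3 * r + 16 * (M * E ^ 3) + M * (x * q) / 2) <=
    145 / 144 * (8 / 3 * r + 33 / 608 * (M * a))).
  { apply Rle_trans with (rho * (8 / 3 * r + 33 / 608 * (M * a))).
    - apply Rmult_le_compat_l; lra.
    - apply Rmult_le_compat_r; lra. }
  assert (H4 : a * (899 / 1000 * M) <= a * a + 145 / 144 * (8 / 3 * r + 33 / 608 * (M * a))).
  { apply Rle_trans with (a * (a + (INR m + 1) * (r / k + M * E ^ 3 / l + M * q * a / 2))).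
    - apply Rmult_le_compat_l; lra.
    - rewrite Rmult_plus_distr_l, I; lra. }
  (* The term [a^2] is absorbed through [a^2 <= 1 <= r]. *)
  assert (H5 : 84 / 100 * (M * a) <= 37 / 10 * r) by nra.
  rewrite <- Hr2 in H5.
  assert (H6 : r * a <= 9 / 2).
  { apply Rmult_le_reg_l with r; [lra|]; lra. }
  assert (0 < r * a) by (apply Rmult_lt_0_compat; lra).
  rewrite <- Hr2; nra.
Qed.

(** [M <= 38 / a^2 <= exp (m a^2 / 32)], and [G <= 6 ln M]. *)
Lemma sum_outer_excess_le (a : R) (m : nat) (rs ws : list Cx) :
  sendov_config a m rs ws ->
  sum_over (outer_excess a) ws <= 3 / 16 * (INR m * a ^ 2).
Proof.
  intros K.
  pose proof (config_a _ _ _ _ K) as Ha.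
  pose proof (config_prod_norm_at_a_sqr _ _ _ _ K) as H.
  pose proof (config_degree_exp _ _ _ _ K) as HE.
  pose proof (prod_norm_at_a_ge_1 _ _ _ _ K) as HM.
  pose proof (sum_outer_excess_le_ln a ws Ha (config_lune _ _ _ _ K)) as HG.
  fold (prod_norm ws a) in HG; set (M := prod_norm ws a) in *.
  set (x := INR m * a ^ 2) in *.
  enough (ln M <= x / 32) by lra.
  rewrite <- (ln_exp (x / 32)).
  apply Rcomplements.ln_le; [lra|].
  assert (HI : exp (- (x / 32)) * exp (x / 32) = 1).
  { rewrite <- exp_plus; replace (- (x / 32) + x / 32) with 0 by ring; apply exp_0. }
  pose proof (exp_pos (x / 32)) as Hp.
  assert (1 <= a ^ 2 / 38 * exp (x / 32)) by (rewrite <- HI; apply Rmult_le_compat_r; lra).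
  assert (0 < a ^ 2) by (apply pow_lt; lra).
  apply Rmult_le_reg_r with (a ^ 2); [auto|]; lra.
Qed.

(* Otherwise the roots, having the same centroid as the critical points, would
   have mean real part close to [a / 2], which makes [P (a / 2)] too small. *)
Lemma sum_inner_defect_ge (a : R) (m : nat) (rs ws : list Cx) :
  sendov_config a m rs ws ->
  1 / 4 * (INR m * a ^ 2) <= sum_over inner_defect ws.
Proof.
  intros K; apply Rnot_lt_le; intros HH.
  pose proof (config_a _ _ _ _ K) as Ha.
  pose proof (config_m _ _ _ _ K) as Hm.
  pose proof (config_degree _ _ _ _ K) as Hx.
  pose proof (prod_norm_at_a_ge_1 _ _ _ _ K) as HM.
  pose proof (prod_norm_at_a_le _ _ _ _ K) as HP.
  pose proof (sum_outer_excess_le _ _ _ _ K) as HG.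
  pose proof (config_degree_exp _ _ _ _ K) as HE.
  pose proof (sum_re_critical a ws) as Hre.
  rewrite (config_length_ws _ _ _ _ K) in Hre.
  pose proof (config_centroid _ _ _ _ K) as Hcen.
  (* For [|r| <= 1], [|a/2 - r|^2 <= 1 - a Re r + a^2/4]. The summand with factor 0 gives the shape
     of [sum_over_lin]. *)
  assert (Hsq : prod_norm rs (a / 2) ^ 2 <=
    exp (sum_over (fun r => - a * fst r + 0 * fst r + (a / 2) ^ 2) rs)).
  { apply prod_Xsub_sqr_le_exp; intros r Hr.
    eapply Rle_trans; [|apply exp_ineq1_le].
    pose proof (config_disk _ _ _ _ K r Hr); pose proof (Cnorm_ge_0 r).
    assert (Cnorm r ^ 2 <= 1) by nra.
    rewrite Cnorm_sqr in *; simpl in *; lra. }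
  rewrite sum_over_lin, (config_length_rs _ _ _ _ K), S_INR in Hsq.
  rewrite S_INR in Hcen.
  set (G := sum_over (outer_excess a) ws) in *.
  set (H := sum_over inner_defect ws) in *.
  set (x := INR m * a ^ 2) in *.
  assert (Hexp : exp (- a * sum_over fst rs + 0 * sum_over fst rs + (INR m + 1) * (a / 2) ^ 2)
    <= exp (- (x / 32))).
  { apply exp_le_compat.
    apply Rmult_le_reg_l with (INR m); [lra|].
    replace (INR m * (- a * sum_over fst rs + 0 * sum_over fst rs + (INR m + 1) * (a / 2) ^ 2))
      with ((INR m + 1) * (x / 4) - a * (INR m * sum_over fst rs)) by (unfold x; field).
    rewrite Hcen.
    replace ((INR m + 1) * (x / 4) - a * ((INR m + 1) * sum_over fst ws)) with
      ((INR m + 1) * (x / 4 - 2 * a * sum_over fst ws / 2)) by field.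
    rewrite Hre.
    (* With [G <= 3x/16] and [H < x/4] the left side is at most [- x/4 + 7x/32]. *)
    assert (x / 4 - (x - G - H) / 2 <= - (x / 32)) by lra.
    apply Rle_trans with ((INR m + 1) * (- (x / 32))).
    - apply Rmult_le_compat_l; lra.
    - nra. }
  (* Now [|P (a/2)|^2 <= a^2/38 <= 1/38], against [|P (a/2)| >= 0.899 M >= 0.899]. *)
  assert (a ^ 2 <= 1) by nra; nra.
Qed.

(** * Bounds for [|P c|] on the two halves of the interval *)

(** Here [H >= m a^2 / 4] has weight at least [1/2], which makes [D s <= E^4 exp (- k s)]; the
    integral of [P'] is then negligible. *)
Lemma prod_norm_left_half_le (a : R) (m : nat) (rs ws : list Cx) (c : R) :
  sendov_config a m rs ws -> 0 <= c <= a / 2 -> prod_norm rs c <= a + 3 / 100.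
Proof.
  intros K Hc.
  pose proof (config_a _ _ _ _ K) as Ha.
  pose proof (config_m _ _ _ _ K) as Hm.
  pose proof (sum_outer_excess_le _ _ _ _ K) as HG.
  pose proof (sum_inner_defect_ge _ _ _ _ K) as HH.
  destruct (config_small _ _ _ _ _ K eq_refl) as [[HE0 HE1] [HE2 HE3]].
  assert (E4 : exp (- (INR m * a ^ 2 / 16)) = exp (- (INR m * a ^ 2 / 64)) ^ 4).
  { apply exp_pow_eq; rewrite INR_IZR_INZ; simpl; field. }
  set (E := exp (- (INR m * a ^ 2 / 64))) in *.
  assert (Hma : 0 < INR m * a) by (apply Rmult_lt_0_compat; lra).
  set (G := sum_over (outer_excess a) ws) in *.
  set (H := sum_over inner_defect ws) in *.
  (* [5/32 = (1/2 - 3/16) / 2]: the decay from [a - s >= a/2], less the contribution of [G]. *)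
  set (k := 5 * INR m * a / 32).
  assert (HD : forall s, 0 <= s <= a / 2 ->
    prod_norm ws s <= E ^ 4 * exp (- (k * s)) + 0 * exp (- (1 * s)) + 0).
  { intros s Hs; rewrite Rmult_0_l, !Rplus_0_r.
    eapply Rle_trans; [apply (prod_norm_le_exp _ _ _ _ s K)|].
    fold G H; rewrite <- E4, <- exp_plus; apply exp_le_compat.
    assert (Ht : 0 <= s / a <= 1 / 2).
    { split; [apply Rdiv_le_0_compat; lra|].
      apply Rmult_le_reg_r with a; [lra|]; field_simplify; lra. }
    assert (HG' : s / a * G <= s / a * (3 / 16 * (INR m * a ^ 2))) by
      (apply Rmult_le_compat_l; lra).
    replace (s / a * (3 / 16 * (INR m * a ^ 2))) with (3 / 16 * (INR m * a * s)) in HG'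
      by (field; lra).
    assert (1 / 2 * H <= (1 - s / a) * H).
    { apply Rmult_le_compat_r; [|lra].
      pose proof (config_degree _ _ _ _ K); lra. }
    assert (Hms : 0 <= INR m * s) by (apply Rmult_le_pos; lra).
    assert (INR m * s * (a / 2) <= INR m * s * (a - s)) by (apply Rmult_le_compat_l; lra).
    unfold k; lra. }
  pose proof (prod_norm_left_le a m rs ws c (E ^ 4) 0 k 1 0 K Hc
    ltac:(apply pow_le; lra) ltac:(lra) ltac:(unfold k; lra) ltac:(lra) ltac:(lra) HD) as HP.
  eapply Rle_trans; [exact HP|]; apply Rplus_le_compat_l.
  rewrite S_INR.
  replace ((INR m + 1) * (E ^ 4 / k + 0 / 1 + 0 * a / 2)) with
    ((1 + / INR m) * (32 / 5) * (E ^ 4 / a)) by (unfold k; field; lra).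
  assert (/ INR m <= / 144) by (apply Rinv_le_contravar; lra).
  assert (0 < / INR m) by (apply Rinv_0_lt_compat; lra).
  assert (HE4' : E ^ 4 <= a / 2432).
  { replace (E ^ 4) with (E ^ 2 * E ^ 2) by ring.
    assert (E ^ 2 <= 1 / 64) by nra.
    pose proof (pow2_ge_0 E).
    apply Rle_trans with (1 / 64 * (a ^ 2 / 38)).
    - apply Rmult_le_compat; lra.
    - nra. }
  assert (HEa : E ^ 4 / a <= 1 / 2432).
  { apply Rmult_le_reg_r with a; [lra|].
    unfold Rdiv at 1; rewrite Rmult_assoc, Rinv_l by lra; lra. }
  assert (0 <= E ^ 4 / a) by (apply Rdiv_le_0_compat; [apply pow_le|]; lra).
  nra.
Qed.

(** [|P'| <= N M] on the whole of [[0, a]], and [P a = 0]. *)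
Lemma prod_norm_le_near_a (a : R) (m : nat) (rs ws : list Cx) (c : R) :
  sendov_config a m rs ws -> 0 <= c <= a ->
  prod_norm rs c <= INR (S m) * prod_norm ws a * (a - c).
Proof.
  intros K Hc.
  set (N := INR (S m)); set (M := prod_norm ws a).
  pose proof (prod_norm_at_a_ge_1 _ _ _ _ K) as HM; fold M in HM.
  pose proof (pos_INR m) as Hm.
  pose proof (peval_increment_le (prod_Xsub rs) (fun s => N * M * s) (fun _ => N * M)
    c a ltac:(lra)) as H; cbv beta in H.
  rewrite (config_root _ _ _ _ K), Cnorm_sub_sym in H.
  replace (Csub (peval (prod_Xsub rs) (RtoC c)) C0) with
    (peval (prod_Xsub rs) (RtoC c)) in H by ring.
  rewrite Rmult_minus_distr_l; apply H.
  - intros s _; auto_derive; [auto | ring].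
  - intros s Hs; rewrite (config_deriv _ _ _ _ K), Cnorm_mul, Cnorm_RtoC by apply pos_INR.
    apply Rmult_le_compat_l; [apply pos_INR|].
    eapply Rle_trans; [apply (prod_norm_le_at_a _ _ _ _ s K); lra|].
    fold M; rewrite <- (Rmult_1_r M) at 2.
    apply Rmult_le_compat_l; [lra|].
    rewrite <- exp_0; apply exp_le_compat.
    assert (0 <= INR m * (s * (a - s))) by (repeat apply Rmult_le_pos; lra); lra.
Qed.

Lemma prod_norm_le_of_config (a : R) (m : nat) (rs ws : list Cx) (c : R) :
  sendov_config a m rs ws -> 0 <= c <= a -> prod_norm rs c <= 1 + a.
Proof.
  intros K Hc.
  pose proof (config_a _ _ _ _ K) as Ha.
  destruct (Rle_dec c (a / 2)) as [Hca|Hca].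
  { pose proof (prod_norm_left_half_le _ _ _ _ c K ltac:(lra)); lra. }
  pose proof (config_m _ _ _ _ K) as Hm.
  pose proof (config_degree _ _ _ _ K) as Hx.
  pose proof (prod_norm_at_a_ge_1 _ _ _ _ K) as HM.
  pose proof (prod_norm_left_half_le _ _ _ _ (a / 2) K ltac:(lra)) as Hk.
  pose proof (prod_norm_le_near_a _ _ _ _ c K Hc) as H1.
  pose proof (log_deriv_mul_prod_norm_le _ _ _ _ c K ltac:(lra)) as H2.
  pose proof (prod_norm_at_a_le_log_deriv_mul _ _ _ _ K) as H3.
  pose proof (Cnorm_log_deriv_at_a _ _ _ _ K) as H4.
  pose proof (prod_norm_le_at_a _ _ _ _ c K Hc) as H5.
  pose proof (exp_decay_split (INR m) a (a - c) ltac:(lra) ltac:(lra) ltac:(lra)) as H6.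
  replace ((a - c) * (a - (a - c))) with (c * (a - c)) in H6 by ring.
  assert (Hq : exp (- (3 * (INR m * a ^ 2) / 32)) <= 1 / 1000).
  { destruct (config_small _ _ _ _ _ K eq_refl) as [[HE0 HE1] _].
    rewrite (exp_pow_eq 6 _ (- (INR m * a ^ 2 / 64)))
      by (rewrite INR_IZR_INZ; simpl; field).
    apply Rle_trans with ((1 / 8) ^ 6); [apply pow_incr; lra | lra]. }
  assert (HN : 0 < INR (S m)) by (rewrite S_INR; lra).
  assert (Hy : 0 <= prod_norm rs c) by apply Cnorm_ge_0.
  assert (Hk0 : 0 <= prod_norm rs (a / 2)) by apply Cnorm_ge_0.
  assert (Hs0 : 0 <= Cnorm (log_deriv ws (RtoC a))) by apply Cnorm_ge_0.
  set (y := prod_norm rs c) in *; set (kap := prod_norm rs (a / 2)) in *.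
  set (M := prod_norm ws a) in *; set (N := INR (S m)) in *.
  set (sig := Cnorm (log_deriv ws (RtoC a))) in *.
  set (t := a - c) in *.
  assert (HNM : 0 < N * M) by (apply Rmult_lt_0_compat; lra).
  assert (Ht : 0 <= t) by (unfold t; lra).
  (* In the near case [N M] is eliminated by [0.899 N M <= sig kap] and [sig <= m]; the cutoff works
     because [1.7 (a + 0.03) <= 0.899 (1 + a)] for [a < 1]. *)
  destruct (Rle_dec (INR m * t) (17 / 10)) as [Hmt|Hmt].
  - assert (899 / 1000 * (N * M) * t <= sig * kap * t) by (apply Rmult_le_compat_r; lra).
    assert (sig * (kap * t) <= INR m * (kap * t)) by
      (apply Rmult_le_compat_r; [apply Rmult_le_pos; lra | lra]).
    assert (kap * (INR m * t) <= kap * (17 / 10)) by (apply Rmult_le_compat_l; lra).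
    lra.
  (* [51/80 = 3/8 * 17/10]. A rational majorant of the exponential reduces the end of the proof to
     polynomial inequalities in [a]. *)
  - assert (Hv : exp (- (3 * INR m * a / 8 * t)) <= / (1 + 51 / 80 * a)).
    { rewrite exp_Ropp; apply Rinv_le_contravar; [lra|].
      eapply Rle_trans; [|apply exp_ineq1_le].
      assert (a * (17 / 10) <= a * (INR m * t)) by (apply Rmult_le_compat_l; lra).
      lra. }
    set (v := / (1 + 51 / 80 * a)) in *.
    assert (Hv1 : v * (1 + 51 / 80 * a) = 1) by (unfold v; apply Rinv_l; lra).
    assert (Hv0 : 0 < v) by (unfold v; apply Rinv_0_lt_compat; lra).
    assert (H7 : prod_norm ws c <= M * (v + 1 / 1000)).
    { eapply Rle_trans; [exact H5|]; apply Rmult_le_compat_l; lra. }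
    assert (H8 : sig * y <= N * M * (1101 / 1000 + v)).
    { eapply Rle_trans; [exact H2|].
      rewrite Rmult_assoc; apply Rmult_le_compat_l; lra. }
    assert (H9 : sig * (899 / 1000 * y) <= sig * (kap * (1101 / 1000 + v))).
    { assert (899 / 1000 * (N * M) * (1101 / 1000 + v) <= sig * kap * (1101 / 1000 + v)) by
        (apply Rmult_le_compat_r; lra).
      lra. }
    (* [sig = 0] would contradict [0 < 0.899 N M <= sig kap]; so [sig] cancels in [H9]. *)
    assert (Hsig : 0 < sig).
    { apply Rnot_le_lt; intros Hle; assert (sig = 0) by lra; nra. }
    apply Rmult_le_reg_l in H9; [|auto].
    assert (H10 : kap * (1101 / 1000 + v) <= (a + 3 / 100) * (1101 / 1000 + v)) by
      (apply Rmult_le_compat_r; lra).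
    assert (H11 : (a + 3 / 100) * (1101 / 1000 + v) <= 899 / 1000 * (1 + a)).
    { apply Rmult_le_reg_r with (1 + 51 / 80 * a); [lra|].
      replace ((a + 3 / 100) * (1101 / 1000 + v) * (1 + 51 / 80 * a)) with
        ((a + 3 / 100) * (1101 / 1000 * (1 + 51 / 80 * a) + v * (1 + 51 / 80 * a))) by ring.
      rewrite Hv1; nra. }
    lra.
Qed.

(** * From a counterexample to a configuration *)

Lemma peval_prod_Xsub_root (ws : list Cx) (w : Cx) :
  In w ws -> peval (prod_Xsub ws) w = C0.
Proof.
  induction ws as [|v ws IH]; intros H; [destruct H|].
  cbn [prod_Xsub]; rewrite peval_pmul_Xsub; destruct H as [->|H].
  - ring.
  - rewrite (IH H); ring.
Qed.

Lemma prod_norm_0_le_1 (zs : list Cx) :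
  (forall z, In z zs -> Cnorm z <= 1) -> prod_norm zs 0 <= 1.
Proof.
  unfold prod_norm; induction zs as [|z zs IH]; intros H; cbn [prod_Xsub].
  - replace (peval (RtoC 1 :: nil) (RtoC 0)) with (RtoC 1) by (simpl; ring).
    rewrite Cnorm_RtoC; lra.
  - rewrite peval_pmul_Xsub, Cnorm_mul.
    assert (H1 := H z (or_introl eq_refl)).
    assert (H2 := IH (fun v Hv => H v (or_intror Hv))).
    replace (Csub (RtoC 0) z) with (Copp z) by (change (RtoC 0) with C0; ring).
    rewrite Cnorm_opp.
    pose proof (Cnorm_ge_0 z); pose proof (Cnorm_ge_0 (peval (prod_Xsub zs) (RtoC 0))).
    nra.
Qed.

(** Gauss-Lucas and the hypothesis on critical points place them in the lune; the two terms of
    [N1 a] give the two degree conditions. *)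
Lemma sendov_config_exists (n : nat) (a : R) (zs : list Cx) :
  0 < a < 1 -> (1 <= n)%nat -> length zs = (n - 1)%nat ->
  (forall z, In z zs -> Cnorm z <= 1) -> contradicts_sendov a zs -> INR n >= N1 a ->
  exists ws, sendov_config a (n - 1) (RtoC a :: zs) ws.
Proof.
  intros Ha Hn Hl Hz Hs HN.
  assert (Ha2 : 0 < a ^ 2) by (apply pow_lt; lra).
  assert (H1 : 9 * ((4 + 2 * a) / a) ^ 2 <= INR n) by
    (eapply Rle_trans; [apply Rmax_l|]; apply Rge_le, HN).
  assert (H2 : 32 * ln (40 / a ^ 2) / a ^ 2 <= INR n) by
    (eapply Rle_trans; [apply Rmax_r|]; apply Rge_le, HN).
  destruct n as [|m]; [lia|].
  replace (S m - 1)%nat with m in * by lia.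
  rewrite S_INR in H1, H2.
  (* [9 (4 + 2a)^2 = 144 + 144 a + 36 a^2], more than enough for the loss [a^2] from [n] to
     [m = n - 1]. *)
  assert (Hdeg : 144 <= INR m * a ^ 2).
  { apply (Rmult_le_compat_r (a ^ 2)) in H1; [|lra].
    replace (9 * ((4 + 2 * a) / a) ^ 2 * a ^ 2) with (9 * (4 + 2 * a) ^ 2) in H1 by (field; lra).
    nra. }
  assert (Hm : (0 < m)%nat).
  { destruct m; [simpl in Hdeg; lra | lia]. }
  destruct (CriticalPoints.pderiv_prod_Xsub (RtoC a :: zs) m) as [ws [Hlw [Hd Hc]]].
  { simpl; now rewrite Hl. }
  { now apply (ssrbool.introT ssrnat.ltP). }
  exists ws; constructor; auto.
  - apply peval_prod_Xsub_root; now left.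
  - cbn [prod_Xsub]; rewrite peval_pmul_Xsub, Cnorm_mul.
    pose proof (prod_norm_0_le_1 zs Hz) as Hp; unfold prod_norm in Hp.
    rewrite Cnorm_sub_sym.
    replace (Csub (RtoC a) (RtoC 0)) with (RtoC a) by (change (RtoC 0) with C0; ring).
    rewrite Cnorm_RtoC by lra.
    rewrite <- (Rmult_1_r a) at 2; apply Rmult_le_compat_l; lra.
  - intros r [<-|Hr]; [rewrite Cnorm_RtoC; lra | auto].
  - simpl; now rewrite Hl.
  - intros w Hw.
    assert (Hw0 : peval (pderiv (prod_Xsub (RtoC a :: zs))) w = C0).
    { rewrite Hd, (peval_prod_Xsub_root ws w Hw); ring. }
    split.
    + apply (Gauss_Lucas_unit_disk (RtoC a :: zs)); [discriminate | | exact Hw0].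
      intros r [<-|Hr]; [rewrite Cnorm_RtoC; lra | auto].
    + rewrite Cnorm_sub_sym; left; exact (Hs w Hw0).
  - apply (Rmult_le_compat_r (a ^ 2)) in H2; [|lra].
    replace (32 * ln (40 / a ^ 2) / a ^ 2 * a ^ 2) with (32 * ln (40 / a ^ 2)) in H2
      by (field; lra).
    (* Passing from [n] to [n - 1] costs a factor at most [exp (1/32) <= 32/31], and
       [40 * 31/32 >= 38]. *)
    assert (H3 : ln (40 / a ^ 2) <= INR m * a ^ 2 / 32 + 1 / 32) by nra.
    apply exp_le_compat in H3.
    assert (H40 : 0 < 40 / a ^ 2) by (apply Rdiv_lt_0_compat; lra).
    rewrite exp_ln, exp_plus in H3 by auto.
    assert (H4 : exp (1 / 32) <= 32 / 31).
    { replace (32 / 31) with (/ (1 + - (1 / 32))) by field.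
      replace (1 / 32) with (- (- (1 / 32))) at 1 by ring.
      rewrite exp_Ropp; apply Rinv_le_contravar; [lra | apply exp_ineq1_le]. }
    set (X := exp (INR m * a ^ 2 / 32)) in *.
    assert (HX : 0 < X) by apply exp_pos.
    assert (H5 : 40 / a ^ 2 <= X * (32 / 31)) by
      (eapply Rle_trans; [exact H3|]; apply Rmult_le_compat_l; lra).
    rewrite exp_Ropp; fold X.
    replace (a ^ 2 / 38) with (/ (38 / a ^ 2)) by (field; lra).
    apply Rinv_le_contravar; [apply Rdiv_lt_0_compat; lra|].
    unfold Rdiv in *; lra.
Qed.

Theorem mainTheorem5 (n : nat) (a c : R) (zs : list Cx) :
  0 < a < 1 ->
  0 < c < a ->
  (1 <= n)%nat ->
  length zs = (n - 1)%nat ->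
  (forall z, In z zs -> Cnorm z <= 1) ->
  contradicts_sendov a zs ->
  INR n >= Rmax (N1 a) (N2 a c) ->
  Cnorm (peval (sendov_poly a zs) (RtoC c)) <= 1 + a.
Proof.
  intros Ha Hc Hn Hl Hz Hs HN.
  destruct (sendov_config_exists n a zs Ha Hn Hl Hz Hs) as [ws K].
  { apply Rle_ge; eapply Rle_trans; [apply Rmax_l | apply Rge_le, HN]. }
  apply (prod_norm_le_of_config _ _ _ _ c K); lra.
Qed.
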